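(* Let $p=4$ or $p=6$. For every $p$-angulation $D$ of a polygon $P$, there exist exactly two triangulations $T_D^{\circ}$ and $T_D^{\bullet}$ of $P$ such that the frieze of type $\Lambda_p$ associated to $D$ and the Conway--Coxeter frieze of $T_D^{\circ}$ coincide in every second row, and likewise the frieze of type $\Lambda_p$ associated to $D$ and the Conway--Coxeter frieze of $T_D^{\bullet}$ coincide in every second row. (That is, there are exactly two triangulations $T$ of $P$ whose Conway--Coxeter frieze coincides in every second row with the frieze of type $\Lambda_p$ associated to $D$.)
   Context: A frieze of width $n$ is an array of real numbers $(m_{i,j})$, indexed by $i\in\mathbb{Z}$ and $j$ with $-2\le j-i\le n+1$, such that $m_{i,i-2}=m_{i,i+n+1}=0$, $m_{i,i-1}=m_{i,i+n}=1$, the remaining entries are positive, and the unimodular rule $m_{i,i+r}m_{i+1,i+r+1}-m_{i+1,i+r}m_{i,i+r+1}=1$ holds for all $i\in\mathbb{Z}$ and $-1\le r\le n$. The $r$-th row is $(m_{i,i+r})_{i\in\mathbb{Z}}$; the row $r=0$ is called the quiddity row. The quiddity row determines the frieze via $m_{i,i+r}=m_{i,i}m_{i+1,i+r}-m_{i+2,i+r}$. A $p$-angulation $D$ of a convex regular polygon $P$ is a set of non-intersecting diagonals partitioning $P$ into a finite collection of $p$-gons (a triangulation is the case $p=3$). Let $P$ have $n+3$ vertices, labelled $0,1,\dots,n+2$ in cyclic order. For a vertex $\alpha$, let $q_\alpha$ be the number of $p$-gons of $D$ incident with $\alpha$, and let $\lambda_p=2\cos(\pi/p)$. The frieze of type $\Lambda_p$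 associated to $D$ is the frieze of width $n$ with $m_{i,i}=\lambda_p q_{i \bmod (n+3)}$ for all $i\in\mathbb{Z}$ (it is known that such a frieze exists and is unique). For $p=3$, $\lambda_3=1$, and the frieze so associated to a triangulation $T$ of $P$ is called the Conway--Coxeter frieze of $T$; its entries in the rows $-1\le r\le n$ are positive integers. Two friezes $(m_{i,j})$ and $(m'_{i,j})$ of width $n$ coincide in every second row if $m_{i,i+r}=m'_{i,i+r}$ for all $i\in\mathbb{Z}$ and all odd $r$ with $-1\le r\le n+1$. *)

(* Defs.v *)
From mathcomp Require Import all_boot all_order all_algebra.
From mathcomp Require Import reals trigo.

Set Implicit Arguments.
Unset Strict Implicit.
Unset Printing Implicit Defensive.

Import Order.TTheory GRing.Theory Num.Theory.

Section Polygon.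
Variable n : nat.

(* The vertices of a convex polygon with n + 3 vertices, in cyclic order;
   a segment is the 2-element set of its endpoints. *)
Local Notation vertex := 'I_n.+3.

Definition is_side (e : {set vertex}) : bool :=
  [exists a : vertex, e == [set a; ordS a]].

Definition is_diagonal (e : {set vertex}) : bool :=
  (#|e| == 2) && ~~ is_side e.

(* Starting at a and following the cyclic order, one meets b strictly after a
   and then c strictly after b, before returning to a. *)
Definition cyclic (a b c : vertex) : bool :=
  [|| (a < b) && (b < c), (b < c) && (c < a) | (c < a) && (a < b)].

(* In a convex polygon two segments meet in a point interior to both iff
   their endpoints are distinct and alternate around the polygon. *)
Definition crossing (e f : {set vertex}) : bool :=
  [exists a, exists b, exists c, exists d : vertex,
    [&& e == [set a; b], f == [set c; d], cyclic a c b & cyclic b d a]].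

(* b is the first element of S met strictly after a, where a and b are
   distinct elements of S. *)
Definition consecutive (S : {set vertex}) (a b : vertex) : bool :=
  [&& a \in S, b \in S, a != b & [forall c in S, ~~ cyclic a c b]].

(* When D is a set of pairwise non-crossing diagonals, the pieces into which
   D cuts the polygon are its subpolygons all of whose edges are sides of the
   polygon or diagonals in D, and none of whose diagonals is in D.  A piece is
   represented by its set S of vertices. *)
Definition is_piece (D : {set {set vertex}}) (S : {set vertex}) : bool :=
  (2 < #|S|) &&
  [forall a in S, forall b in S, (a != b) ==>
     ((consecutive S a b || consecutive S b a)
      == (is_side [set a; b] || ([set a; b] \in D)))].

Definition p_angulation (p : nat) (D : {set {set vertex}}) : Prop :=
  [/\ forall e, e \in D -> is_diagonal e,
      forall e f, e \in D -> f \in D -> ~~ crossing e f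
    & forall S, is_piece D S -> #|S| = p].

Definition triangulation (T : {set {set vertex}}) : Prop := p_angulation 3 T.

Definition incident_pieces (D : {set {set vertex}}) (a : vertex) : nat :=
  #|[set S : {set vertex} | is_piece D S & a \in S]|.

End Polygon.

Local Open Scope ring_scope.

(* An array is a total function of (i, j); only its values in the band
   -2 <= j - i <= n + 1 are constrained, or used below. *)
Definition is_frieze (R : realType) (n : nat) (m : int -> int -> R) : Prop :=
  [/\ forall i : int, m i (i - 2) = 0 /\ m i (i + n%:Z + 1) = 0,
      forall i : int, m i (i - 1) = 1 /\ m i (i + n%:Z) = 1,
      forall i r : int, 0 <= r -> r <= n%:Z - 1 -> 0 < m i (i + r)
    & forall i r : int, -1 <= r -> r <= n%:Z ->
        m i (i + r) * m (i + 1) (i + r + 1)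
        - m (i + 1) (i + r) * m i (i + r + 1) = 1].

Definition vertex_mod (n : nat) (i : int) : 'I_n.+3 :=
  inord `|(i %% (n.+3)%:Z)%Z|%N.

Definition lambda (R : realType) (p : nat) : R := 2 * cos (pi / p%:R).

Definition frieze_of_type (R : realType) (n p : nat)
    (D : {set {set 'I_n.+3}}) (m : int -> int -> R) : Prop :=
  is_frieze n m /\
  forall i : int, m i i = lambda R p * (incident_pieces D (vertex_mod n i))%:R.

Definition conway_coxeter (R : realType) (n : nat)
    (T : {set {set 'I_n.+3}}) (m : int -> int -> R) : Prop :=
  frieze_of_type 3 T m.

Definition coincide_every_second_row (R : realType) (n : nat)
    (m m' : int -> int -> R) : Prop :=
  forall i r : int, -1 <= r -> r <= n%:Z + 1 -> odd `|r|%N ->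
    m i (i + r) = m' i (i + r).

(* Main.v *)
(* For a dissection [D], a vertex lies in one piece less than it has incident
   edges (sides or diagonals in [D]).  For a triangulation, splitting off the
   triangle under an edge again and again gives integer vectors [v_0, .., v_(n+2)]
   with [v_(i-1) + v_(i+1) = q_i v_i]; the frieze consists of the determinants
   [det(v_(i-1), v_(j+1))].  These determinants are positive and equal [1]
   exactly on the edges, so the quiddity determines the triangulation.

   When [p = 2 h] is even, every edge of a [p]-angulation [D] joins vertices of
   opposite parity.  For [h <= 3], joining in each piece the vertices of one
   parity gives a triangulation, whose quiddity is [h q] at these vertices and
   [q] at the others.  Since [lambda_p ^ 2 = h], its frieze is that of [D] after
   rescaling the rows with even [r] by [lambda_p] or its inverse.

   Conversely, if the friezes of [T] and [D] agree for [r = 1], the quiddities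
   satisfy [q^T_i q^T_(i+1) = h q^D_i q^D_(i+1)].  At two adjacent vertices with
   [q^D = 1] this is the prime [h], so [q^T] takes there the values [1] and [h];
   these propagate around the polygon and leave the two triangulations above. *)

Require Import Defs.
From mathcomp Require Import all_boot all_order all_algebra.
From mathcomp Require Import reals trigo.
From mathcomp Require Import zify ring lra.

Set Implicit Arguments.
Unset Strict Implicit.
Unset Printing Implicit Defensive.

Import Order.TTheory GRing.Theory Num.Theory.

Lemma eq_ordE k (x y : 'I_k) : (x == y) = (x == y :> nat).
Proof. by []. Qed.

Ltac ord_bound x k :=
  lazymatch goal with
  | H : is_true (leq (S (nat_of_ord x)) k) |- _ => fail
  | _ => pose proof (ltn_ord x)
  end.

(** Cyclic order becomes linear arithmetic on the labels, once each vertex in sight has its bound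
    [x < k] in the context. *)
Ltac ordlia :=
  intros; try (apply/val_inj); try (apply/negP; intro);
  unfold cyclic in *; rewrite ?eq_ordE;
  repeat match goal with
    | H : @eq (ordinal _) _ _ |- _ => apply (congr1 (@nat_of_ord _)) in H
    | H : context [@eq_op _ _ _] |- _ => progress (rewrite !eq_ordE in H)
    end; simpl in *;
  repeat match goal with
    | H : context [@nat_of_ord ?k ?x] |- _ => ord_bound x k
    | |- context [@nat_of_ord ?k ?x] => ord_bound x k
    end;
  repeat match goal with
    | H : context [if ?c then _ else _] |- _ => destruct c eqn:?
    | |- context [if ?c then _ else _] => destruct c eqn:?
    end; lia.

(** * Pieces of a dissection *)

Section Dissection.
Variable n : nat.
Local Notation vertex := 'I_n.+3.
Implicit Types (a b c d u v x y s t : vertex) (S : {set vertex}).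

(** The number of steps from [a] to [b] in cyclic order. Measured from one origin, cyclic statements
    become linear ones, see [cyclic_dist]. *)
Definition dist a b : nat := if a <= b then b - a else b + n.+3 - a.

Lemma val_ordS a : nat_of_ord (ordS a) = if a < n.+2 then a.+1 else 0.
Proof.
case: a => a /= la; case: ltnP => h; first by rewrite modn_small.
by have -> : a.+1 = n.+3 by [lia]; rewrite modnn.
Qed.

Lemma dist_inj o : injective (dist o).
Proof. by move=> x y; rewrite /dist => h; apply/ord_inj; move: h; ordlia. Qed.

Lemma distxx o : dist o o = 0.
Proof. by rewrite /dist leqnn subnn. Qed.

Lemma dist_ordS o : dist o (ordS o) = 1.
Proof. by rewrite /dist val_ordS; ordlia. Qed.

Lemma dist_succ o s : dist o s < n.+2 -> dist o (ordS s) = (dist o s).+1.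
Proof.
have hs := ltn_ord s; have ho := ltn_ord o.
rewrite /dist val_ordS; case: (ltnP s n.+2) => h1; case: (leqP o s) => h2.
- by case: ifP; lia.
- by case: ifP; lia.
- by case: ifP; lia.
- by case: ifP; lia.
Qed.

Lemma cyclic_dist o x y z : cyclic x y z =
  [|| dist o x < dist o y < dist o z, dist o y < dist o z < dist o x
    | dist o z < dist o x < dist o y].
Proof.
have hx := ltn_ord x; have hy := ltn_ord y; have hz := ltn_ord z.
have ho := ltn_ord o.
rewrite /cyclic /dist.
case: (leqP o x) => ?; case: (leqP o y) => ?; case: (leqP o z) => ?; lia.
Qed.

(** The vertices other than [x] and [y] fill two open arcs, and [z] lies on neither. *)
Lemma cyclic_end x y z : x != y -> ~~ cyclic x z y -> ~~ cyclic y z x ->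
  z = x \/ z = y.
Proof.
move=> xy h1 h2; case: (eqVneq z x) => zx; [by left|right; ordlia].
Qed.

Lemma next_in S a c : c \in S -> c != a ->
  exists b, [/\ b \in S, b != a & forall d, d \in S -> ~~ cyclic a d b].
Proof.
move=> cS ca; pose P b := (b \in S) && (b != a).
have Pc : P c by rewrite /P cS.
case: (arg_minnP (dist a) Pc) => b /andP[bS ba] bmin; exists b; split=> // d dS.
case: (eqVneq d a) => [->|da]; first by ordlia.
have := bmin d; rewrite /P dS da => /(_ isT); rewrite /dist /=; ordlia.
Qed.

Lemma prev_in S a c : c \in S -> c != a ->
  exists b, [/\ b \in S, b != a & forall d, d \in S -> ~~ cyclic b d a].
Proof.
move=> cS ca; pose P b := (b \in S) && (b != a).
have Pc : P c by rewrite /P cS.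
case: (arg_minnP (dist^~ a) Pc) => b /andP[bS ba] bmin; exists b; split=> // d dS.
case: (eqVneq d a) => [->|da]; first by ordlia.
have := bmin d; rewrite /P dS da => /(_ isT); rewrite /dist /=; ordlia.
Qed.

Lemma consecutiveP S a b :
  reflect [/\ a \in S, b \in S, a != b & forall c, c \in S -> ~~ cyclic a c b]
          (consecutive S a b).
Proof.
apply: (iffP and4P) => -[h1 h2 h3 h4]; split=> //.
- by move=> c cS; move/forallP: h4 => /(_ c); rewrite cS.
- by apply/forallP => c; apply/implyP; apply: h4.
Qed.

Lemma other_mem S a : 1 < #|S| -> exists2 c, c \in S & c != a.
Proof.
move=> h; have: 0 < #|S :\ a|.
  by move: h; rewrite (cardsD1 a S); case: (a \in S) => //= /ltnW.
by case/card_gt0P => c; rewrite !inE => /andP[ca cS]; exists c.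
Qed.

Lemma consecutive_next S a : 1 < #|S| -> a \in S -> exists b, consecutive S a b.
Proof.
move=> hS aS; have [c cS ca] := other_mem a hS.
have [b [bS ba h]] := next_in cS ca.
by exists b; apply/consecutiveP; split=> //; rewrite eq_sym.
Qed.

(** By [nextP], the default [x] is not returned when [x] lies in a set [S] of at least two
    elements. *)
Definition next S x := odflt x [pick y | consecutive S x y].

Lemma nextP S x : 1 < #|S| -> x \in S -> consecutive S x (next S x).
Proof.
move=> S1 xS; rewrite /next; case: pickP => //= h.
by have [y] := consecutive_next S1 xS; rewrite h.
Qed.

Lemma consecutive_prev S a : 1 < #|S| -> a \in S -> exists b, consecutive S b a.
Proof.
move=> hS aS; have [c cS ca] := other_mem a hS.
have [b [bS ba h]] := prev_in cS ca.
by exists b; apply/consecutiveP; split.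
Qed.

Lemma consecutive_inj_r S a b c : consecutive S a b -> consecutive S a c -> b = c.
Proof.
move=> /consecutiveP[aS bS ab h] /consecutiveP[_ cS ac h'].
have := h _ cS; have := h' _ bS; ordlia.
Qed.

Lemma consecutive_inj_l S a b c : consecutive S b a -> consecutive S c a -> b = c.
Proof.
move=> /consecutiveP[bS aS ab h] /consecutiveP[cS _ ac h'].
have := h _ cS; have := h' _ bS; ordlia.
Qed.

(** A third element of [S] lies on one of the two arcs between [a] and [b]. *)
Lemma consecutive_asym S a b : 2 < #|S| -> consecutive S a b -> ~~ consecutive S b a.
Proof.
move=> hS /consecutiveP[aS bS ab h]; apply/negP => /consecutiveP[_ _ _ h'].
have : 0 < #|S :\ a :\ b|.
  move: hS; rewrite (cardsD1 a S) aS (cardsD1 b (S :\ a)).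
  by case: (b \in _) => //= /ltnW.
case/card_gt0P => c; rewrite !inE => /and3P[cb ca cS].
have := h _ cS; have := h' _ cS; ordlia.
Qed.

(** Take the members of [S] nearest to [c] on either side. *)
Lemma gap_in S c : 1 < #|S| -> c \notin S ->
  exists x y, consecutive S x y /\ cyclic x c y.
Proof.
move=> hS cS; have [d dS dc] := other_mem c hS.
have [y [yS yc hy]] := next_in dS dc.
have [x [xS xc hx]] := prev_in dS dc.
exists x, y.
have [e eS ex] := other_mem x hS.
have exc : e != c by apply: contraNneq cS => <-.
have := hx _ eS; have := hy _ eS; have := hx _ yS; have := hy _ xS => h1 h2 h3 h4.
have xy : x != y by ordlia.
split; last by ordlia.
apply/consecutiveP; split=> // z zS.
have zc : z != c by apply: contraNneq cS => <-.
have := hx _ zS; have := hy _ zS; ordlia.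
Qed.

Lemma is_sideE a b : is_side [set a; b] = (b == ordS a) || (a == ordS b).
Proof.
apply/existsP/orP => [[x /eqP h]|[/eqP->|/eqP->]]; last first.
- by exists b; rewrite setUC.
- by exists a.
have hx : x != ordS x by rewrite eq_ordE val_ordS; ordlia.
have: a \in [set x; ordS x] by rewrite -h !inE eqxx.
have: b \in [set x; ordS x] by rewrite -h !inE eqxx orbT.
have: x \in [set a; b] by rewrite h !inE eqxx.
have: ordS x \in [set a; b] by rewrite h !inE eqxx orbT.
rewrite !inE => h1 h2 /orP[]/eqP eb /orP[]/eqP ea; subst.
- by move: h1 hx; rewrite orbb eq_sym => ->.
- by right.
- by left.
- by move: h2 hx; rewrite orbb => ->.
Qed.

Definition edge (D : {set {set vertex}}) a b :=
  is_side [set a; b] || ([set a; b] \in D).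

(** This is [p_angulation] without the size of the pieces, so that it can be applied to [refine]
    before its pieces are known. *)
Definition dissection (D : {set {set vertex}}) : Prop :=
  (forall e, e \in D -> is_diagonal e) /\
  (forall e f, e \in D -> f \in D -> ~~ crossing e f).

Lemma edge_sym D a b : edge D a b = edge D b a.
Proof. by rewrite /edge setUC. Qed.

Lemma edge_ordS D a : edge D a (ordS a).
Proof. by rewrite /edge is_sideE eqxx. Qed.

Lemma edge_succ D a b : b = a.+1 :> nat -> edge D a b.
Proof.
move=> h; suff -> : b = ordS a by exact: edge_ordS.
by apply/ord_inj; rewrite val_ordS; have := ltn_ord b; ordlia.
Qed.

Lemma is_pieceP D S :
  reflect (2 < #|S| /\ forall a b, a \in S -> b \in S -> a != b ->
             consecutive S a b || consecutive S b a = edge D a b)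
          (is_piece D S).
Proof.
apply: (iffP andP) => -[hS h]; split=> //.
- move=> a b aS bS ab; apply/eqP.
  by move/forall_inP: h => /(_ _ aS)/forall_inP/(_ _ bS)/implyP/(_ ab).
- apply/forall_inP => a aS; apply/forall_inP => b bS; apply/implyP => ab.
  exact/eqP/h.
Qed.

Lemma piece_gt2 D S : is_piece D S -> 2 < #|S|.
Proof. by case/is_pieceP. Qed.

Lemma piece_gt1 D S : is_piece D S -> 1 < #|S|.
Proof. by move/piece_gt2; lia. Qed.

Lemma piece_edge D S a b : is_piece D S -> consecutive S a b -> edge D a b.
Proof.
move=> /is_pieceP[_ h] c; case/consecutiveP: (c) => aS bS ab _.
by rewrite -h // c.
Qed.

(** * Edges against pieces in a fixed dissection *)

Section Fixed.
Variable D : {set {set vertex}}.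
Hypothesis dD : dissection D.

Lemma edge_neq a b : edge D a b -> a != b.
Proof.
case/orP; first by rewrite is_sideE; case/orP => /eqP ->; rewrite eq_ordE val_ordS; ordlia.
by move/dD.1/andP => -[]; rewrite cards2; case: (a != b).
Qed.

(** Sides are covered as well: one of the two open arcs between the ends of a side contains no
    vertex. *)
Lemma edge_noncrossing a b c d :
  edge D a b -> edge D c d -> cyclic a c b -> cyclic b d a -> False.
Proof.
move=> /orP[|hab].
  rewrite is_sideE !eq_ordE !val_ordS => h _; ordlia.
move=> /orP[|hcd].
  rewrite is_sideE !eq_ordE !val_ordS; ordlia.
move=> h1 h2; have /negP[] := dD.2 _ _ hab hcd.
apply/existsP; exists a; apply/existsP; exists b.
by apply/existsP; exists c; apply/existsP; exists d; rewrite !eqxx h1.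
Qed.

(** Otherwise [y] lies in a gap between consecutive [s] and [t] of [S]. The edge [xy] cannot cross
    the edge [st], so [x] lies on the closed arc from [s] to [t], and then [u] or [v] falls inside
    the gap. *)
Lemma piece_separator_mem S x y u v : is_piece D S -> edge D x y ->
  u \in S -> v \in S -> cyclic x u y -> cyclic y v x -> y \in S.
Proof.
move=> pS xy uS vS hu hv; apply/negPn/negP => yS.
have [s [t [st hy]]] := gap_in (piece_gt1 pS) yS.
have hst := piece_edge pS st.
move: st => /consecutiveP[_ _ _ h].
rewrite edge_sym in xy.
have hx : ~ cyclic t x s by apply: edge_noncrossing hst xy hy.
have := h _ uS; have := h _ vS; ordlia.
Qed.

(** Both ends of [xy] belong to [S]. An edge between members of a piece joins consecutive ones, yet
    [u] and [v] lie on its two sides. *)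
Lemma piece_not_crossed S x y u v : is_piece D S -> edge D x y ->
  u \in S -> v \in S -> cyclic x u y -> cyclic y v x -> False.
Proof.
move=> pS xy uS vS hu hv.
have yS := piece_separator_mem pS xy uS vS hu hv.
have xS : x \in S by apply: (piece_separator_mem pS _ vS uS hv hu); rewrite edge_sym.
have [_ /(_ x y xS yS (edge_neq xy))] := is_pieceP _ _ pS.
rewrite xy => /orP[] /consecutiveP[_ _ _ h].
- by have := h _ uS; rewrite hu.
- by have := h _ vS; rewrite hv.
Qed.

(** The gap of [S] around [c] is closed by an edge [xy], which [S'] cannot cross. *)
Lemma pieces_separated S S' c : is_piece D S -> is_piece D S' ->
  c \in S' -> c \notin S ->
  exists x y, [/\ consecutive S x y, cyclic x c y
                & forall d, d \in S' -> ~~ cyclic y d x].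
Proof.
move=> pS pS' cS' cS; have [x [y [xy h]]] := gap_in (piece_gt1 pS) cS.
exists x, y; split=> // d dS'; apply/negP => hd.
exact: piece_not_crossed pS' (piece_edge pS xy) cS' dS' h hd.
Qed.

(** If [S'] had a vertex [c] outside [S], an edge [xy] of [S] would separate the two, so [a] and [b]
    would be [x] and [y]. In this order [c] lies between them; in the other, [xy] is consecutive in
    both directions. *)
Lemma piece_subset S S' a b : is_piece D S -> is_piece D S' ->
  consecutive S a b -> consecutive S' a b -> S' \subset S.
Proof.
move=> pS pS' ab ab'; apply/subsetP => c cS'; apply/negPn/negP => cS.
have [x [y [xy hc h]]] := pieces_separated pS pS' cS' cS.
have yx := consecutive_asym (piece_gt2 pS) xy.
move: (ab') (ab) (xy) => /consecutiveP[aS' bS' nab h1] /consecutiveP[aS bS _ h2].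
move=> /consecutiveP[xS yS nxy h3].
have end_xy z : z \in S -> z \in S' -> z = x \/ z = y.
  by move=> zS zS'; apply: cyclic_end nxy (h3 _ zS) (h _ zS').
case: (end_xy a aS aS') => ea; case: (end_xy b bS bS') => eb; subst.
- by rewrite eqxx in nab.
- by have := h1 _ cS'; rewrite hc.
- by rewrite ab in yx.
- by rewrite eqxx in nab.
Qed.

Lemma piece_eq S S' a b : is_piece D S -> is_piece D S' ->
  consecutive S a b -> consecutive S' a b -> S = S'.
Proof.
move=> pS pS' ab ab'; apply/eqP; rewrite eqEsubset.
by rewrite (piece_subset pS' pS ab' ab) (piece_subset pS pS' ab ab').
Qed.

Lemma edge_noncrossing_dist o x y s t : edge D x y -> edge D s t ->
  dist o x < dist o s -> dist o s < dist o y -> dist o y < dist o t -> False.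
Proof.
move=> xy st h1 h2 h3; apply: (edge_noncrossing xy st).
- by rewrite (cyclic_dist o) h1 h2.
- by rewrite (cyclic_dist o) h3 (ltn_trans h1 h2) !orbT.
Qed.

Lemma max_neighbor o s K : dist o s < K -> K < n.+3 -> exists y,
  [/\ edge D s y, dist o s < dist o y <= K
    & forall z, edge D s z -> dist o z <= K -> dist o z <= dist o y].
Proof.
move=> hs hK.
have hn : dist o s < dist o (ordS s) <= K by rewrite dist_succ; lia.
pose P y := edge D s y && (dist o s < dist o y <= K).
have Pn : P (ordS s) by rewrite /P edge_ordS.
case: (arg_maxnP (dist o) Pn) => y /andP[sy hy] ymax; exists y; split=> // z sz hz.
case: (leqP (dist o z) (dist o s)) => h; first by case/andP: hy; lia.
by apply: ymax; rewrite /P sz h.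
Qed.

(* A vertex is discarded when an edge other than [ab] cuts it off from [ab]. *)
Lemma piece_exists a b : edge D a b -> a != ordS b ->
  exists2 S, is_piece D S & consecutive S a b.
Proof.
move=> ab nab; have [K KE] : exists K, dist b a = K by exists (dist b a).
pose cut c := [exists x, exists y, [&& edge D x y, dist b x < dist b c,
  dist b c < dist b y, dist b y <= K & (dist b x != 0) || (dist b y != K)]].
have cutP c x y : ~~ cut c -> edge D x y -> dist b x < dist b c ->
    dist b c < dist b y -> dist b y <= K -> dist b x = 0 /\ dist b y = K.
  move=> ncut xy h1 h2 h3.
  suff /andP[/eqP-> /eqP->] : (dist b x == 0) && (dist b y == K) by [].
  move: ncut; apply: contraR => h.
  apply/existsP; exists x; apply/existsP; exists y.
  by rewrite xy h1 h2 h3; move: h; rewrite negb_and.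
have KN : K < n.+3 by rewrite -KE /dist; ordlia.
have K1 : 1 < K.
  have nab' := edge_neq ab.
  by move: nab nab'; rewrite eq_ordE val_ordS -KE /dist; ordlia.
pose S := [set c | (dist b c <= K) && ~~ cut c].
have bS : b \in S.
  rewrite inE distxx /=; apply/existsP => -[x /existsP[y]].
  by rewrite distxx /= andbF.
have aS : a \in S.
  rewrite inE KE leqnn /=; apply/existsP => -[x /existsP[y]].
  by rewrite KE => /and4P[_ _ h1 /andP[h2 _]]; lia.
have S_cut c : c \in S -> dist b c <= K /\ ~~ cut c by rewrite inE => /andP.
have consec_ab : consecutive S a b.
  apply/consecutiveP; split=> //; first exact: edge_neq ab.
  by move=> c /S_cut[hc _]; rewrite (cyclic_dist b) distxx KE; lia.
exists S => //.
(* It remains to see that the edges between members of [S] join exactly the consecutive ones;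
   distances are measured from [b]. *)
have consec_edge s t : s \in S -> t \in S -> dist b s < dist b t ->
    edge D s t = consecutive S s t || consecutive S t s.
  move=> sS tS st; have [hs cs] := S_cut _ sS; have [ht ct] := S_cut _ tS.
  case: (boolP ((dist b s == 0) && (dist b t == K))) => [/andP[/eqP s0 /eqP tK]|nst].
    have -> : s = b by apply: (@dist_inj b); rewrite s0 distxx.
    have -> : t = a by apply: (@dist_inj b); rewrite tK KE.
    by rewrite consec_ab orbT edge_sym.
  apply/idP/orP => [est|[]].
  - left; apply/consecutiveP; split=> //; first exact: edge_neq est.
    move=> c /S_cut[hc cc]; rewrite (cyclic_dist b); apply/negP => h.
    have /andP[q1 q2] : dist b s < dist b c < dist b t by move: h st; clear; lia.
    have [h1 h2] := cutP _ _ _ cc est q1 q2 ht.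
    by move: nst; rewrite h1 h2 !eqxx.
  - move=> /consecutiveP[_ _ _ h].
    (* Let [y] be the farthest neighbour of [s] up to [t]. If [y] is not [t], some edge [xz] cuts
       [y] off. With [x] before [s] it cuts off [s]; with [x] after [s] it crosses [sy]; with
       [x = s] it contradicts the choice of [y] or cuts off [t]. *)
    have [y [sy /andP[hy1 hy2] ymax]] := max_neighbor st (leq_ltn_trans ht KN).
    case: (ltngtP (dist b y) (dist b t)) hy2 => // [hy _|/dist_inj<-//].
    have : y \notin S.
      by apply/negP => /h; rewrite (cyclic_dist b) hy1 hy.
    rewrite inE negb_and -ltnNge negbK => /orP[|]; first by move: hy ht; clear; lia.
    case/existsP => x /existsP[z /and5P[xz h1 h2 h3 h4]].
    case: (ltngtP (dist b x) (dist b s)) => hx.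
    + have [q1 q2] := cutP _ _ _ cs xz hx (ltn_trans hy1 h2) h3.
      by rewrite q1 q2 !eqxx in h4.
    + by case: (edge_noncrossing_dist sy xz hx h1 h2).
    + have xs := dist_inj hx; subst x.
      case: (leqP (dist b z) (dist b t)) => hz; first by have := ymax z xz hz; rewrite leqNgt h2.
      have [q1 q2] := cutP _ _ _ ct xz st hz h3.
      by rewrite q1 q2 !eqxx in h4.
  - move=> /consecutiveP[_ _ _ h].
    have := h a aS; have := h b bS; rewrite !(cyclic_dist b) distxx KE => h1 h2.
    by suff : False by []; move: h1 h2 st hs ht nst; clear; lia.
apply/is_pieceP; split; last first.
  move=> s t sS tS nst.
  case: (ltngtP (dist b s) (dist b t)) => h; last by rewrite (dist_inj h) eqxx in nst.
  - by rewrite consec_edge.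
  - by rewrite edge_sym consec_edge // orbC.
(* A third member of [S] is the farthest neighbour of [b] strictly before [a]; the bound [K.-1]
   excludes [a] itself. *)
have h0 : dist b b < K.-1 by rewrite distxx; lia.
have [|y [by_ /andP[hy1 hy2] ymax]] := max_neighbor h0; first by lia.
have yS : y \in S.
  rewrite inE; apply/andP; split; first by lia.
  apply/existsP => -[x /existsP[z /and5P[xz h1 h2 h3 h4]]].
  case: (posnP (dist b x)) => hx.
    have xb : x = b by apply: (@dist_inj b); rewrite hx distxx.
    have := ymax z; rewrite -xb => /(_ xz); rewrite xb; rewrite hx eqxx /= in h4; lia.
  by apply: (edge_noncrossing_dist (o := b) by_ xz); rewrite ?distxx.
have yb : b != y by apply: edge_neq by_.
have ya : a != y by apply: contraTneq hy2 => <-; rewrite KE -ltnNge; lia.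
have abn : a != b by apply: edge_neq ab.
have sub : [set a; b; y] \subset S.
  by apply/subsetP => z; rewrite !in_setU !in_set1 => /orP[/orP[]|] /eqP->.
apply: leq_trans (subset_leq_card sub).
by rewrite setUC cardsU1 cards2 !inE negb_or abn ![y == _]eq_sym ya yb.
Qed.

Lemma consecutive_neq_ordS S a b : is_piece D S -> consecutive S a b -> a != ordS b.
Proof.
move=> pS ab; apply/eqP => e.
have := consecutive_asym (piece_gt2 pS) ab; apply/negP; rewrite negbK.
case/consecutiveP: ab => aS bS nab _.
apply/consecutiveP; split=> //; first by rewrite eq_sym.
move=> c _; rewrite e (cyclic_dist b) distxx dist_ordS; lia.
Qed.

(** Sending a piece at [a] to its edge from [a] to the next member is a bijection, by [piece_exists]
    and [piece_eq]. The side from [a] back to its predecessor is left out, as no piece follows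
    it. *)
Lemma incident_pieces_edges a :
  incident_pieces D a = #|[set b | edge D a b & a != ordS b]|.
Proof.
rewrite /incident_pieces.
pose f S := next S a.
have fP S : is_piece D S -> a \in S -> consecutive S a (f S).
  by move=> pS; apply: nextP; exact: piece_gt1 pS.
have f_eq S b : is_piece D S -> consecutive S a b -> f S = b.
  move=> pS ab; case/consecutiveP: (ab) => aS _ _ _.
  exact: consecutive_inj_r (fP _ pS aS) ab.
rewrite -(@card_in_imset _ _ f).
  congr #|pred_of_set _|; apply/setP => b; rewrite inE.
  apply/imsetP/andP => [[S]|[ab nab]].
    rewrite inE => /andP[pS aS] ->; have c := fP _ pS aS.
    by split; [apply: piece_edge c|apply: consecutive_neq_ordS c].
  have [S pS ab'] := piece_exists ab nab.
  exists S; last by rewrite (f_eq S b).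
  by rewrite inE pS; case/consecutiveP: ab'.
move=> S S'; rewrite !inE => /andP[pS aS] /andP[pS' aS'] e.
apply: (piece_eq pS pS' (fP _ pS aS)); rewrite e; exact: fP.
Qed.

Lemma incident_pieces_degree a : (incident_pieces D a).+1 = #|[set b | edge D a b]|.
Proof.
rewrite incident_pieces_edges (cardsD1 (ord_pred a) [set b | edge D a b]).
have ha : edge D (ord_pred a) a by rewrite -{2}(ord_predK a) edge_ordS.
rewrite inE edge_sym ha.
rewrite add1n; congr _.+1; apply: eq_card => b; rewrite !inE andbC; congr (_ && _).
by rewrite -(inj_eq (@ordS_inj _) b) ord_predK eq_sym.
Qed.

End Fixed.
End Dissection.

(** * Vectors attached to a triangulation *)

Section Triangulation.
Variable n : nat.
Local Notation vertex := 'I_n.+3.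
Implicit Types (a b c d i j k u v x y s t : vertex) (S : {set vertex}).

Lemma p_angulation_dissection p (D : {set {set vertex}}) :
  p_angulation p D -> dissection D.
Proof. by case. Qed.

Lemma consecutive_bounds S a b c : consecutive S b a -> a < b -> c \in S -> a <= c <= b.
Proof. by move=> /consecutiveP[_ _ _ h] ab /h; ordlia. Qed.

Section NonCrossing.
Variable D : {set {set vertex}}.
Hypothesis dD : dissection D.

Lemma edge_noncrossing_lt x y s t : edge D x y -> edge D s t ->
  x < s -> s < y -> y < t -> False.
Proof. by move=> xy st h1 h2 h3; apply: (edge_noncrossing dD xy st); ordlia. Qed.

(** For an edge [ab] this is the degree of [x] in the subpolygon with vertices [a, .., b]. *)
Definition degree_in a b x := #|[set y : vertex | (a <= y <= b) && edge D x y]|.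

Lemma degree_in_succl a b : b = a.+1 :> nat -> degree_in a b a = 1.
Proof.
move=> ba; rewrite -(cards1 b); apply: eq_card => y; rewrite !inE.
apply/andP/eqP => [[h /(edge_neq dD)]|->]; first by ordlia.
by split; [lia|exact: edge_succ].
Qed.

Lemma degree_in_succr a b : b = a.+1 :> nat -> degree_in a b b = 1.
Proof.
move=> ba; rewrite -(cards1 a); apply: eq_card => y; rewrite !inE.
apply/andP/eqP => [[h /(edge_neq dD)]|->]; first by ordlia.
by split; [lia|rewrite edge_sym; exact: edge_succ].
Qed.

Section Apex.
Variables a b c : vertex.
Hypotheses (ac : a < c) (cb : c < b).
Hypotheses (eab : edge D a b) (eac : edge D a c) (ecb : edge D c b).

(** Beyond [c] the vertex [a] sees only [b], because any other edge from [a] would cross [cb]. *)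
Lemma degree_in_left : degree_in a b a = (degree_in a c a).+1.
Proof.
rewrite /degree_in (cardsD1 b) inE eab leqnn (ltnW (ltn_trans ac cb)) /= add1n.
congr _.+1; apply: eq_card => y; rewrite !inE.
apply/and3P/andP => [[yb h ay]|[h ay]].
- split=> //; have := @edge_noncrossing_lt _ _ _ _ ay ecb; ordlia.
- by split=> //; ordlia.
Qed.

Lemma degree_in_right : degree_in a b b = (degree_in c b b).+1.
Proof.
rewrite /degree_in (cardsD1 a) inE edge_sym eab leqnn (ltnW (ltn_trans ac cb)) /= add1n.
congr _.+1; apply: eq_card => y; rewrite !inE.
apply/and3P/andP => [[yb h ay]|[h ay]].
- split=> //; rewrite edge_sym in ay.
  have := @edge_noncrossing_lt _ _ _ _ eac ay; ordlia.
- by split=> //; ordlia.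
Qed.

Lemma degree_in_apex : degree_in a b c = degree_in a c c + degree_in c b c.
Proof.
rewrite /degree_in -cardsUI [X in _ + X]eq_card0 ?addn0.
  apply: eq_card => y; rewrite !inE -andb_orl; congr andb; lia.
move=> y; rewrite !inE; apply/andP => -[/andP[h1 h2] /andP[h3 _]].
have := edge_neq dD h2; ordlia.
Qed.

Lemma degree_in_below x : a < x -> x < c -> degree_in a b x = degree_in a c x.
Proof.
move=> ax xc; apply: eq_card => y; rewrite !inE.
case: (boolP (edge D x y)) => xy; rewrite ?andbT ?andbF //.
have := @edge_noncrossing_lt _ _ _ _ eac xy ax xc; lia.
Qed.

Lemma degree_in_above x : c < x -> x < b -> degree_in a b x = degree_in c b x.
Proof.
move=> ax xc; apply: eq_card => y; rewrite !inE.
case: (boolP (edge D x y)) => xy; rewrite ?andbT ?andbF //.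
rewrite edge_sym in xy.
have := fun h => @edge_noncrossing_lt _ _ _ _ xy ecb h ax xc; lia.
Qed.

End Apex.

Local Open Scope ring_scope.

(* [f] solves the recurrence [f (j - 1) + f (j + 1) = q_j f j], where
   [q_j = degree_in a b j - 1], as if [f] continued by [- f b] before [a] and
   by [- f a] after [b]. *)
Definition recurrent a b (f : vertex -> int) : Prop :=
  [/\ forall j, j = a.+1 :> nat -> f j + f a = f b + f a *+ degree_in a b a,
      forall j, j.+1 = b :> nat -> f j + f b = f a + f b *+ degree_in a b b
    & forall i j k, (a <= i)%N -> j = i.+1 :> nat -> k = j.+1 :> nat -> (k <= b)%N ->
        f i + f k + f j = f j *+ degree_in a b j].

Lemma eq_recurrent a b (f g : vertex -> int) : (a < b)%N ->
  (forall z : vertex, (a <= z <= b)%N -> f z = g z) ->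
  recurrent a b f -> recurrent a b g.
Proof.
move=> ab fg [h1 h2 h3]; have fa := fg a; have fb := fg b.
rewrite leqnn ltnW // in fa; rewrite leqnn ltnW // in fb.
split=> [j hj|j hj|i j k hi hj hk hb].
- by rewrite -fa // -fb // -fg ?h1 //; lia.
- by rewrite -fa // -fb // -fg ?h2 //; lia.
- by rewrite -!fg ?(h3 i) //; lia.
Qed.

(** At [a] and [b] the degree grows by one, which [f c = f a + f b] absorbs. At [c] the boundary
    equations of the two halves add up to the inner equation. *)
Lemma recurrent_glue a b c f : (a < c)%N -> (c < b)%N ->
  edge D a b -> edge D a c -> edge D c b -> f c = f a + f b ->
  recurrent a c f -> recurrent c b f -> recurrent a b f.
Proof.
move=> ac cb eab eac ecb fc [l1 l2 l3] [r1 r2 r3]; split=> [j hj|j hj|i j k hi hj hk hb].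
- by rewrite (degree_in_left ac cb) // l1 // fc mulrS; ring.
- by rewrite (degree_in_right ac cb) // r2 // fc mulrS; ring.
- case: (ltngtP j c) => jc.
  + by rewrite (degree_in_below ac cb) ?l3 //; lia.
  + by rewrite (degree_in_above ac cb) ?r3 //; lia.
  + have {}jc : j = c by exact: val_inj.
    subst j; rewrite (degree_in_apex ac cb) // mulrnDr.
    have l := l2 i (esym hj); have r := r1 k hk.
    have -> : f c *+ degree_in a c c = f i + f c - f a by rewrite l; ring.
    have -> : f c *+ degree_in c b c = f k + f c - f b by rewrite r; ring.
    by rewrite fc; ring.
Qed.

End NonCrossing.

(** The piece bordered by [ab] on the side of the labels between them has three vertices, so the
    successor of [a] in it is the predecessor of [b]. *)
Lemma triangulation_apex T a b : triangulation T -> edge T a b -> a.+1 < b ->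
  exists c, [/\ a < c, c < b, edge T a c & edge T c b].
Proof.
move=> hT ab lab; have dT := p_angulation_dissection hT.
have [||S pS ba] := @piece_exists _ _ dT b a.
- by rewrite edge_sym.
- by rewrite eq_ordE val_ordS; ordlia.
have S3 : #|S| = 3 by case: hT => _ _; apply.
case/consecutiveP: (ba) => bS aS nba _.
have [x ax] := consecutive_next (piece_gt1 pS) aS.
have [y yb] := consecutive_prev (piece_gt1 pS) bS.
case/consecutiveP: (ax) => _ xS nax _; case/consecutiveP: (yb) => yS _ nyb _.
have xb : x != b.
  by apply: contraTneq ax => ->; apply: consecutive_asym (piece_gt2 pS) ba.
have ya : y != a.
  by apply: contraTneq yb => ->; apply: consecutive_asym (piece_gt2 pS) ba.
have c1 : #|S :\ a :\ b| = 1.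
  apply/eqP; rewrite -(eqn_add2l 2); apply/eqP.
  transitivity #|S|; last by rewrite S3.
  by rewrite (cardsD1 a S) aS (cardsD1 b (S :\ a)) !inE nba bS.
have xy : x = y.
  case/eqP/cards1P: c1 => z hz.
  have : x \in [set z] by rewrite -hz !inE xb eq_sym nax.
  have : y \in [set z] by rewrite -hz !inE nyb ya.
  by rewrite !inE => /eqP-> /eqP->.
subst y; exists x; split; [| | exact: piece_edge ax | exact: piece_edge yb].
- have := consecutive_bounds ba (ltnW lab) xS; ordlia.
- have := consecutive_bounds ba (ltnW lab) xS; ordlia.
Qed.

Local Open Scope ring_scope.

Definition det (X Y : vertex -> int) x y : int := X x * Y y - X y * Y x.

Lemma detxx X Y x : det X Y x x = 0.
Proof. exact: subrr. Qed.

(* Across an apex [c], Ptolemy's relation forces [det > 1] off the edge [ab]. *)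
Lemma det_glue (X Y : vertex -> int) a b c x y :
  X c = X a + X b -> Y c = Y a + Y b -> det X Y a b = 1 ->
  det X Y x y = det X Y y b * det X Y x c
    + det X Y c y * det X Y x c + det X Y c y * det X Y a x.
Proof.
move=> Xc Yc hab; rewrite -[LHS]mulr1 -hab /det Xc Yc; ring.
Qed.

(** Induction on the length of the interval. The apex [c] gets the sum of the vectors at [a] and
    [b], which has determinant 1 with both; the end vectors are arbitrary so that the induction
    hypothesis applies to both halves. *)
Lemma interval_vectors T : triangulation T ->
  forall m a b, (b - a <= m)%N -> (a < b)%N -> edge T a b ->
  forall xa ya xb yb : int, xa * yb - xb * ya = 1 ->
  exists X Y : vertex -> int,
    [/\ [/\ X a = xa, X b = xb, Y a = ya & Y b = yb],
        recurrent T a b X, recurrent T a b Y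
      & forall x y, (a <= x)%N -> (x < y)%N -> (y <= b)%N ->
          0 < det X Y x y /\ edge T x y = (det X Y x y == 1)].
Proof.
move=> hT; have dT := p_angulation_dissection hT.
elim=> [|m IH] a b hm ab eab xa ya xb yb hd; first by lia.
move: (ab); rewrite leq_eqVlt => /orP[/eqP lab|lab].
  pose f (fa fb : int) (z : vertex) := if z == a then fa else fb.
  have nba : b != a by ordlia.
  have fE fa fb : f fa fb a = fa /\ f fa fb b = fb by rewrite /f eqxx (negPf nba).
  have rec fa fb : recurrent T a b (f fa fb).
    have [ha hb] := fE fa fb; split=> [j hj|j hj|]; last by ordlia.
    - have -> : j = b by ordlia.
      by rewrite degree_in_succl // addrC.
    - have -> : j = a by ordlia.
      by rewrite degree_in_succr // addrC.
  exists (f xa xb), (f ya yb); have [-> ->] := fE xa xb; have [-> ->] := fE ya yb.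
  split=> // x y ax xy yb'.
  have -> : x = a by ordlia.
  have -> : y = b by ordlia.
  rewrite /det; have [-> ->] := fE xa xb; have [-> ->] := fE ya yb.
  by rewrite hd eab eqxx.
have [c [ac cb eac ecb]] := triangulation_apex hT eab lab.
have [||X1 [Y1 [[X1a X1c Y1a Y1c] rX1 rY1 h1]]] :=
  IH a c _ ac eac xa ya (xa + xb) (ya + yb); [lia|rewrite -hd; ring|].
have [||X2 [Y2 [[X2c X2b Y2c Y2b] rX2 rY2 h2]]] :=
  IH c b _ cb ecb (xa + xb) (ya + yb) xb yb; [lia|rewrite -hd; ring|].
pose glue (f1 f2 : vertex -> int) (z : vertex) := if (z <= c)%N then f1 z else f2 z.
have glue1 f1 f2 (z : vertex) : (a <= z <= c)%N -> f1 z = glue f1 f2 z.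
  by rewrite /glue => /andP[_ ->].
have glue2 f1 f2 (z : vertex) : f1 c = f2 c -> (c <= z <= b)%N -> f2 z = glue f1 f2 z.
  rewrite /glue => h /andP[cz _]; case: leqP => // zc.
  by have -> : z = c by ordlia.
have Xc : X1 c = X2 c by rewrite X1c X2c.
have Yc : Y1 c = Y2 c by rewrite Y1c Y2c.
pose X := glue X1 X2; pose Y := glue Y1 Y2.
have Xa : X a = xa by rewrite /X -glue1 // leqnn ltnW.
have Ya : Y a = ya by rewrite /Y -glue1 // leqnn ltnW.
have Xb : X b = xb by rewrite /X -glue2 // leqnn ltnW.
have Yb : Y b = yb by rewrite /Y -glue2 // leqnn ltnW.
have Xcc : X c = X a + X b by rewrite Xa Xb /X -glue1 // leqnn ltnW.
have Ycc : Y c = Y a + Y b by rewrite Ya Yb /Y -glue1 // leqnn ltnW.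
have {}h1 x y : (a <= x)%N -> (x < y)%N -> (y <= c)%N ->
    0 < det X Y x y /\ edge T x y = (det X Y x y == 1).
  move=> q1 q2 q3; rewrite /det /X /Y -!glue1; try lia.
  exact: h1.
have {}h2 x y : (c <= x)%N -> (x < y)%N -> (y <= b)%N ->
    0 < det X Y x y /\ edge T x y = (det X Y x y == 1).
  move=> q1 q2 q3; rewrite /det /X /Y -!glue2 //; try lia.
  exact: h2.
exists X, Y; split=> //.
- apply: (recurrent_glue dT ac cb) => //.
  + by apply: eq_recurrent rX1 => // z; exact: glue1.
  + by apply: eq_recurrent rX2 => // z; exact: glue2.
- apply: (recurrent_glue dT ac cb) => //.
  + by apply: eq_recurrent rY1 => // z; exact: glue1.
  + by apply: eq_recurrent rY2 => // z; exact: glue2.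
have dab : det X Y a b = 1 by rewrite /det Xa Xb Ya Yb.
move=> x y ax xy yb'.
(* For [x] and [y] on different sides of [c], apart from the pair [a], [b], at least two summands in
   [det_glue] are positive, so the determinant exceeds 1; and [xy] is no edge, as it would cross
   [ac] or [cb]. *)
case: (leqP y c) => yc; first exact: h1.
case: (leqP c x) => cx; first exact: h2.
have [P _] := h1 x c ax cx (leqnn c).
have [Q _] := h2 c y (leqnn c) yc yb'.
case: (eqVneq x a) => [->|xa']; case: (eqVneq y b) => [->|yb''].
- by rewrite dab eab eqxx.
- have noedge : edge T a y = false.
    by apply/negP => e; apply: (edge_noncrossing_lt dT e ecb); ordlia.
  have [|R _] := h2 y b (ltnW yc) _ (leqnn b); first by ordlia.
  have {}P : 0 < det X Y a c by move: P; have [] := h1 a c (leqnn a) ac (leqnn c).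
  have RP := mulr_gt0 R P; have QP := mulr_gt0 Q P.
  rewrite noedge (det_glue a y Xcc Ycc dab) detxx mulr0 addr0; split; lia.
- have noedge : edge T x b = false.
    by apply/negP => e; apply: (edge_noncrossing_lt dT eac e); ordlia.
  have [|S _] := h1 a x (leqnn a) _ (ltnW cx); first by ordlia.
  have {}Q : 0 < det X Y c b by have [] := h2 c b (leqnn c) cb (leqnn b).
  have QS := mulr_gt0 Q S; have QP := mulr_gt0 Q P.
  rewrite noedge (det_glue x b Xcc Ycc dab) detxx mul0r add0r; split; lia.
- have noedge : edge T x y = false.
    by apply/negP => e; apply: (edge_noncrossing_lt dT eac e); ordlia.
  have [|S _] := h1 a x (leqnn a) _ (ltnW cx); first by ordlia.
  have [|R _] := h2 y b (ltnW yc) _ (leqnn b); first by ordlia.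
  have QS := mulr_gt0 Q S; have QP := mulr_gt0 Q P; have RP := mulr_gt0 R P.
  rewrite noedge (det_glue x y Xcc Ycc dab); split; lia.
Qed.

Lemma edge_wrap (D : {set {set vertex}}) : edge D ord0 ord_max.
Proof.
rewrite edge_sym; suff -> : ord0 = ordS (@ord_max n.+2) by exact: edge_ordS.
by apply/ord_inj; rewrite val_ordS /= ltnn.
Qed.

Lemma triangulation_vectors T : triangulation T ->
  exists X Y : vertex -> int,
    [/\ [/\ X ord0 = 1, X ord_max = 0, Y ord0 = 0 & Y ord_max = 1],
        recurrent T ord0 ord_max X, recurrent T ord0 ord_max Y
      & forall x y, (x < y)%N -> 0 < det X Y x y /\ edge T x y = (det X Y x y == 1)].
Proof.
move=> hT.
have h10 : 1 * 1 - 0 * 0 = 1 :> int by [].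
have [X [Y [h1 h2 h3 h4]]] :=
  interval_vectors hT (leqnn (@ord_max n.+2 - @ord0 n.+2)) isT (edge_wrap T) h10.
exists X, Y; split=> // x y xy; apply: h4 => //.
by rewrite -ltnS; exact: ltn_ord.
Qed.

Lemma degree_in_full (D : {set {set vertex}}) x : dissection D ->
  degree_in D ord0 ord_max x = (incident_pieces D x).+1.
Proof.
move=> dD; rewrite incident_pieces_degree //; apply: eq_card => y; rewrite !inE.
by have -> : (ord0 <= y <= @ord_max n.+2)%N by have := ltn_ord y; rewrite ltnS.
Qed.

(** The equation at [ord0] gives the value at 1 from the two end values, and each inner equation
    gives the next value. *)
Lemma recurrent_unique (T T' : {set {set vertex}}) f g :
  (forall x, degree_in T ord0 ord_max x = degree_in T' ord0 ord_max x) ->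
  recurrent T ord0 ord_max f -> recurrent T' ord0 ord_max g ->
  f ord0 = g ord0 -> f ord_max = g ord_max -> f =1 g.
Proof.
move=> dTT' [f1 _ f3] [g1 _ g3] h0 hm.
suff h m : forall x, (x <= m)%N -> f x = g x by move=> x; apply: (h x).
elim: m => [|m IH] x hx.
  by have -> : x = ord0 by apply/ord_inj => /=; lia.
have hxN := ltn_ord x.
case: (ltngtP x m.+1) hx => // [|hx _]; first by rewrite ltnS => /IH.
case: m => [|m] in IH hx *.
  apply: (@addIr _ (f ord0)); rewrite f1 // {2}h0 g1 // h0 hm; congr (_ + _ *+ _).
  by rewrite dTT'.
have hm1 : (m.+1 < n.+3)%N by lia.
have hm2 : (m < n.+3)%N by lia.
have fr := f3 (Ordinal hm2) (Ordinal hm1) x isT erefl hx _.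
have gr := g3 (Ordinal hm2) (Ordinal hm1) x isT erefl hx _.
have {}fr := fr ltac:(rewrite -ltnS; exact: hxN).
have {}gr := gr ltac:(rewrite -ltnS; exact: hxN).
have e1 : f (Ordinal hm1) = g (Ordinal hm1) by exact: IH.
have e2 : f (Ordinal hm2) = g (Ordinal hm2) by apply: IH; exact: leqnSn.
rewrite e1 e2 dTT' -gr in fr.
by move: fr => /addIr/addrI.
Qed.

Lemma eq_dissection (D D' : {set {set vertex}}) : dissection D -> dissection D' ->
  (forall x y, (x < y)%N -> edge D x y = edge D' x y) -> D = D'.
Proof.
move=> dD dD' h.
have hsub (A B : {set {set vertex}}) : dissection A ->
    (forall x y, (x < y)%N -> edge A x y = edge B x y) -> A \subset B.
  move=> dA hAB; apply/subsetP => e eA.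
  have := dA.1 _ eA; rewrite /is_diagonal => /andP[/cards2P[x [y [xy exy]]] ns].
  wlog lxy : x y xy exy / (x < y)%N.
    move=> W; case: (ltngtP x y) => [|l|e0]; first exact: W.
    - by apply: (W y x) => //; [rewrite eq_sym|rewrite setUC].
    - by move: xy; rewrite (ord_inj e0) eqxx.
  have := hAB _ _ lxy; rewrite /edge -exy eA orbT => /esym.
  by rewrite (negPf ns) /= => ->.
by apply/eqP; rewrite eqEsubset !hsub // => x y /h.
Qed.

(** Both triangulations have the same vectors, and these detect the edges by determinant 1. *)
Lemma triangulation_rigid T T' : triangulation T -> triangulation T' ->
  (forall x, incident_pieces T x = incident_pieces T' x) -> T = T'.
Proof.
move=> hT hT' q.
have dT := p_angulation_dissection hT; have dT' := p_angulation_dissection hT'.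
have dTT' x : degree_in T ord0 ord_max x = degree_in T' ord0 ord_max x.
  by rewrite !degree_in_full ?q.
have [X [Y [[X0 Xm Y0 Ym] rX rY h]]] := triangulation_vectors hT.
have [X' [Y' [[X0' Xm' Y0' Ym'] rX' rY' h']]] := triangulation_vectors hT'.
have eX : X =1 X' by apply: (recurrent_unique dTT' rX rX'); rewrite ?X0 ?Xm.
have eY : Y =1 Y' by apply: (recurrent_unique dTT' rY rY'); rewrite ?Y0 ?Ym.
apply: eq_dissection => // x y xy.
have [_ ->] := h _ _ xy; have [_ ->] := h' _ _ xy.
by rewrite /det !eX !eY.
Qed.

End Triangulation.

(** * Triangulations refining a 2h-angulation *)

Section TwoColour.
Variable n : nat.
Local Notation vertex := 'I_n.+3.
Implicit Types (a b c d i j k u v x y s t : vertex) (S : {set vertex}).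

(** The map [next S] permutes [S]. *)
Lemma sum_next S (F : vertex -> nat) : 1 < #|S| ->
  \sum_(x in S) F (next S x) = \sum_(x in S) F x.
Proof.
move=> S1.
have inj : {in S &, injective (next S)}.
  move=> x y xS yS e; have := nextP S1 yS; rewrite -e.
  exact: consecutive_inj_l (nextP S1 xS).
rewrite -(big_imset F inj) /=; apply: eq_bigl => x; congr (x \in pred_of_set _).
apply/eqP; rewrite eqEcard card_in_imset // leqnn andbT.
by apply/subsetP => _ /imsetP[y yS ->]; case/consecutiveP: (nextP S1 yS).
Qed.

Lemma triangle_consecutive a b c : cyclic a b c -> consecutive [set a; b; c] a b.
Proof.
move=> h; apply/consecutiveP; rewrite !inE !eqxx orbT; split=> //; first by ordlia.
by move=> x; rewrite !inE => /orP[/orP[]|] /eqP->; ordlia.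
Qed.

Lemma triangle_piece (D : {set {set vertex}}) a b c : cyclic a b c ->
  edge D a b -> edge D b c -> edge D c a -> is_piece D [set a; b; c].
Proof.
move=> h ab bc ca.
have h1 := triangle_consecutive h.
have h2 : consecutive [set a; b; c] b c.
  rewrite -setUA setUC; apply: triangle_consecutive; ordlia.
have h3 : consecutive [set a; b; c] c a.
  rewrite setUC setUA; apply: triangle_consecutive; ordlia.
have [nab nbc nca] : [/\ a != b, b != c & c != a] by split; ordlia.
apply/is_pieceP; split.
  by rewrite setUC cardsU1 cards2 !inE negb_or nca nab eq_sym nbc.
have ba : edge D b a by rewrite edge_sym.
have cb : edge D c b by rewrite edge_sym.
have ac : edge D a c by rewrite edge_sym.
move=> x y; rewrite !inE => /orP[/orP[]|] /eqP-> /orP[/orP[]|] /eqP-> nxy;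
  rewrite ?eqxx // in nxy *;
  by rewrite ?h1 ?h2 ?h3 ?orbT ?ab ?bc ?ca ?ba ?cb ?ac.
Qed.

Section EvenAngulation.
Variables (h : nat) (D : {set {set vertex}}).
Hypothesis hD : p_angulation h.*2 D.

Let dD : dissection D := p_angulation_dissection hD.

Let card_piece S : is_piece D S -> #|S| = h.*2.
Proof. by case: hD => _ _; apply. Qed.

Lemma half_gt1 : 1 < h.
Proof.
have [|S pS _] := piece_exists dD (edge_ordS D ord0).
  by rewrite eq_ordE !val_ordS.
have := piece_gt2 pS; rewrite (card_piece pS); lia.
Qed.

(** Induction on [b - a]: the other [2h - 1] edges of the piece under [ab] are shorter, so each of
    them flips the parity, and their number is odd. *)
Lemma edge_parity_lt a b : a < b -> edge D a b -> odd b = ~~ odd a.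
Proof.
have [m] := ubnP (b - a); elim: m => // m IH in a b * => hm ab eab.
move: (ab); rewrite leq_eqVlt => /orP[/eqP <- //|lab].
have [||S pS ba] := @piece_exists _ _ dD b a.
- by rewrite edge_sym.
- by rewrite eq_ordE val_ordS; ordlia.
have S1 := piece_gt1 pS; case/consecutiveP: (ba) => bS aS nba _.
have nb : next S b = a by apply: consecutive_inj_r (nextP S1 bS) ba.
have flip x : x \in S -> x != b -> odd x + odd (next S x) = 1.
  move=> xS xb; have xy := nextP S1 xS; move: (next S x) xy => y xy.
  case/consecutiveP: (xy) => _ yS nxy hxy.
  have bx := consecutive_bounds ba ab xS; have by_ := consecutive_bounds ba ab yS.
  have lxy : x < y by have := hxy b bS; ordlia.
  have nxa : ~ (x = a /\ y = b).
    move=> [ex ey]; subst x y; have := consecutive_asym (piece_gt2 pS) xy.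
    by rewrite ba.
  have small : y - x < b - a.
    suff : (x != a) || (y != b) by ordlia.
    by apply/negPn; rewrite negb_or !negbK; apply/negP => /andP[/eqP ? /eqP ?]; apply: nxa.
  rewrite (IH x y _ lxy (piece_edge pS xy)); first by case: (odd x).
  by rewrite -ltnS; apply: leq_trans hm; rewrite ltnS.
(* The left side counts every vertex twice and is even, while [#|S| - 1] is odd; hence
   [odd a + odd b] is odd. *)
have e : \sum_(x in S) (odd x + odd (next S x)) = odd b + odd a + (#|S|).-1.
  rewrite (bigD1 b) //= nb (cardsD1 b S) bS /=; congr (_ + _).
  rewrite -sum1_card; apply: eq_big => [x|x /andP[xS xb]]; last exact: flip.
  by rewrite !inE andbC.
rewrite big_split /= (sum_next (fun x => odd x : nat) S1) (card_piece pS) /= in e.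
have := piece_gt2 pS; rewrite (card_piece pS) => h2; move: e h2.
by move: (\sum_(x in S) _) => s; case: (odd a); case: (odd b) => //=; lia.
Qed.

Lemma edge_parity a b : edge D a b -> odd b = ~~ odd a.
Proof.
move=> ab; case: (ltngtP a b) => l; first exact: edge_parity_lt.
- by rewrite (@edge_parity_lt b a l) ?negbK // edge_sym.
- by have := edge_neq dD ab; rewrite eq_ordE l eqxx.
Qed.

Lemma width_odd : odd n.
Proof. by have /= := edge_parity (edge_wrap D); rewrite negbK. Qed.

Lemma incident_pieces_gt0 a : 0 < incident_pieces D a.
Proof.
rewrite incident_pieces_edges //; apply/card_gt0P; exists (ordS a); rewrite inE edge_ordS /=.
by rewrite eq_ordE !val_ordS; ordlia.
Qed.

(* Above a shortest edge the polygon contributes a piece all of whose other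
   edges are sides, so its inner vertices lie in no other piece. *)
Lemma adjacent_ears : exists u, incident_pieces D u = 1 /\ incident_pieces D (ordS u) = 1.
Proof.
pose P (ab : vertex * vertex) := (ab.1.+1 < ab.2) && edge D ab.1 ab.2.
have P0 : P (ord0, ord_max) by rewrite /P edge_wrap.
case: (arg_minnP (fun ab : vertex * vertex => ab.2 - ab.1) P0) => -[a b] /andP[/= lab ab] abmin.
have inner x : a < x -> x < b -> incident_pieces D x = 1.
  move=> ax xb; apply/eq_add_S; rewrite incident_pieces_degree //.
  have short y z : edge D y z -> y < z -> z - y < b - a -> z = y.+1 :> nat.
    move=> yz lyz sh; case: (ltngtP y.+1 z) => // [l|]; last by lia.
    by have := abmin (y, z); rewrite /P /= l yz => /(_ isT); rewrite leqNgt sh.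
  have vS : nat_of_ord (ordS x) = x.+1 by rewrite val_ordS; have := ltn_ord b; case: ifP; lia.
  have vP : (ord_pred x).+1 = x.
    have := congr1 (@nat_of_ord _) (ord_predK x); rewrite val_ordS; case: ifP => // _ x0.
    by move: ax; rewrite -x0.
  have -> : [set y | edge D x y] = [set ordS x; ord_pred x].
    apply/setP => y; rewrite !inE; apply/idP/orP => [xy|[]/eqP->]; last first.
    - by rewrite edge_sym -{2}(ord_predK x) edge_ordS.
    - exact: edge_ordS.
    have yb : y <= b.
      by rewrite leqNgt; apply/negP => by_; apply: (edge_noncrossing_lt dD ab xy).
    have yx : edge D y x by rewrite edge_sym.
    have ay : a <= y.
      by rewrite leqNgt; apply/negP => ya; apply: (edge_noncrossing_lt dD yx ab).
    have nxy := edge_neq dD xy.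
    case: (ltngtP x y) => l.
    - left; apply/eqP/ord_inj; rewrite vS; apply: short => //; move: l yb ax; clear; lia.
    - right; apply/eqP/ord_inj; have := short _ _ yx l.
      by move=> e; apply/succn_inj; rewrite vP e //; move: l ay xb; clear; lia.
    - by rewrite (ord_inj l) eqxx in nxy.
  by rewrite cards2 eq_ordE vS; move: vP; clear; case: eqVneq; lia.
(* With a single vertex between [a] and [b], the piece under [ab] would have at most three vertices,
   but it has [2h], at least four. *)
have wide : a.+2 < b.
  rewrite ltn_neqAle lab andbT; apply/eqP => e.
  have [||S pS ba] := @piece_exists _ _ dD b a.
  - by rewrite edge_sym.
  - by rewrite eq_ordE val_ordS; ordlia.
  have sub : S \subset [set a; b; ordS a].
    apply/subsetP => x /(consecutive_bounds ba (ltnW lab)) => hx.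
    rewrite !inE !eq_ordE val_ordS; have := ltn_ord b; case: ifP; lia.
  have := subset_leq_card sub; rewrite (card_piece pS) setUC cardsU1 cards2.
  have := half_gt1; case: (_ \notin _); case: (_ != _) => /=; lia.
have bN := ltn_ord b.
have v1 : nat_of_ord (ordS a) = a.+1 by rewrite val_ordS; case: ifP; lia.
have v2 : nat_of_ord (ordS (ordS a)) = a.+2 by rewrite val_ordS v1; case: ifP; lia.
by exists (ordS a); split; apply: inner; rewrite ?v1 ?v2; lia.
Qed.

Variable colour : bool.

(** Each of the [2h] edges of the piece has one end of the chosen parity, and each such vertex is an
    end of two of them. *)
Lemma card_colour S : is_piece D S -> #|[set x in S | odd x == colour]| = h.
Proof.
move=> pS; have S1 := piece_gt1 pS.
pose F (x : vertex) : nat := odd x == colour.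
have e : \sum_(x in S) (F x + F (next S x)) = #|S|.
  rewrite -sum1_card; apply: eq_bigr => x xS; rewrite /F.
  rewrite (edge_parity (piece_edge pS (nextP S1 xS))).
  by case: (odd x) colour => [] [].
rewrite big_split /= (sum_next F S1) (card_piece pS) in e.
have -> : #|[set x in S | odd x == colour]| = \sum_(x in S) F x.
  2: by move: e; move: (\sum_(x in S) _) => s; lia.
rewrite -sum1_card [RHS](bigID (fun x : vertex => odd x == colour)) /=.
rewrite [X in _ = _ + X]big1 ?addn0 => [|x /andP[_ /negPf]]; last by rewrite /F => ->.
apply: eq_big => [x|x]; first by rewrite inE.
by rewrite inE /F => /andP[_ ->].
Qed.

(** For [h = 2] this gives one diagonal in each quadrilateral, for [h = 3] an inscribed triangle in
    each hexagon. *)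
Definition chord x y :=
  [&& x != y, odd x == colour, odd y == colour
    & [exists S, [&& is_piece D S, x \in S & y \in S]]].

Lemma chordP x y : reflect
  [/\ x != y, odd x = colour, odd y = colour & exists S, [/\ is_piece D S, x \in S & y \in S]]
  (chord x y).
Proof.
apply: (iffP and4P) => -[xy /eqP cx /eqP cy hS]; split=> //; try exact/eqP.
- by case/existsP: hS => S /and3P[? ? ?]; exists S.
- by case: hS => S [? ? ?]; apply/existsP; exists S; apply/and3P.
Qed.

Lemma chord_sym x y : chord x y = chord y x.
Proof.
rewrite /chord eq_sym; congr (_ && _); rewrite andbCA; congr [&& _, _ & _].
by apply: eq_existsb => S; rewrite [_ && (y \in S)]andbC.
Qed.

Lemma chord_not_edge x y : chord x y -> ~~ edge D x y.
Proof.
case/chordP => _ cx cy _; apply/negP => /edge_parity; rewrite cx cy.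
by case: colour.
Qed.

(* The two values of [colour] give the paper's two triangulations. *)
Definition refine : {set {set vertex}} :=
  D :|: [set e | [exists x, exists y, chord x y && (e == [set x; y])]].

Lemma edge_refine x y : edge refine x y = edge D x y || chord x y.
Proof.
rewrite /edge inE orbA; congr (_ || _); rewrite inE; apply/existsP/idP => [[a]|c].
  case/existsP => b /andP[ab /eqP e].
  case/chordP: (ab) => nab _ _ _.
  have : a \in [set x; y] by rewrite e !inE eqxx.
  have : b \in [set x; y] by rewrite e !inE eqxx orbT.
  rewrite !inE => /orP[]/eqP eb /orP[]/eqP ea; subst a b => //.
  - by rewrite eqxx in nab.
  - by rewrite chord_sym.
  - by rewrite eqxx in nab.
by exists x; apply/existsP; exists y; rewrite c eqxx.
Qed.

Lemma piece_not_subset S S' : is_piece D S -> is_piece D S' -> S != S' ->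
  exists2 c, c \in S' & c \notin S.
Proof.
move=> pS pS' neq; apply/subsetPn; apply: contraNN neq => sub.
by rewrite eq_sym eqEcard sub (card_piece pS) (card_piece pS') leqnn.
Qed.

(** An edge of [S] separates the two pieces, so common vertices are ends of it. *)
Lemma pieces_share S S' a b : is_piece D S -> is_piece D S' -> S != S' ->
  a \in S -> a \in S' -> b \in S -> b \in S' -> a != b -> edge D a b.
Proof.
move=> pS pS' neq aS aS' bS bS' ab; have [c cS' cS] := piece_not_subset pS pS' neq.
have [x [y [xy _ hS']]] := pieces_separated dD pS pS' cS' cS.
have exy := piece_edge pS xy.
case/consecutiveP: xy => _ _ nxy hS.
have eyx : edge D y x by rewrite edge_sym.
case: (cyclic_end nxy (hS _ aS) (hS' _ aS')) => ea;
  case: (cyclic_end nxy (hS _ bS) (hS' _ bS')) => eb; subst a b => //;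
  by rewrite eqxx in ab.
Qed.

Lemma pieces_not_crossing S S' a b c d : is_piece D S -> is_piece D S' -> S != S' ->
  a \in S -> b \in S -> c \in S' -> d \in S' ->
  cyclic a c b -> cyclic b d a -> False.
Proof.
move=> pS pS' neq aS bS cS' dS'; have [e eS' eS] := piece_not_subset pS pS' neq.
have [x [y [xy _ hS']]] := pieces_separated dD pS pS' eS' eS.
case/consecutiveP: xy => _ _ nxy hS.
have : 0 < dist x y.
  by rewrite lt0n; apply: contraNneq nxy; rewrite -(distxx x) => /dist_inj->.
move: (hS _ aS) (hS _ bS) (hS' _ cS') (hS' _ dS').
rewrite !(cyclic_dist x) distxx; clear; lia.
Qed.

Hypothesis h_le3 : h <= 3.

(** Two crossing chords must lie in one piece and would use four of its vertices of one parity, but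
    there are only [h <= 3]. *)
Lemma refine_noncrossing a b c d :
  edge refine a b -> edge refine c d -> cyclic a c b -> cyclic b d a -> False.
Proof.
move=> + + h1 h2; rewrite !edge_refine => /orP[ab|ab] /orP[cd|cd].
- exact: (edge_noncrossing dD ab cd h1 h2).
- case/chordP: cd => _ _ _ [S [pS cS dS]].
  exact: (piece_not_crossed dD pS ab cS dS h1 h2).
- case/chordP: ab => _ _ _ [S [pS aS bS]].
  by apply: (piece_not_crossed dD pS cd bS aS); move: h1 h2; clear; ordlia.
- case/chordP: ab => nab ca cb [S [pS aS bS]].
  case/chordP: cd => ncd cc cd [S' [pS' cS' dS']].
  case: (eqVneq S S') => [eS|neq]; last exact: (pieces_not_crossing pS pS' neq aS bS cS' dS' h1 h2).
  subst S'; have := card_colour pS.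
  have sub : [set a; b; c; d] \subset [set x in S | odd x == colour].
    apply/subsetP => x; rewrite !inE => /orP[/orP[/orP[]|]|] /eqP->.
    + by rewrite aS ca eqxx.
    + by rewrite bS cb eqxx.
    + by rewrite cS' cc eqxx.
    + by rewrite dS' cd eqxx.
  have : #|[set a; b; c; d]| = 4.
    have [q1 q2 q3 q4] : [/\ c != a, c != b, d != a & d != b].
      by move: h1 h2; clear; split; ordlia.
    rewrite setUC cardsU1 [[set a; b] :|: _]setUC cardsU1 cards2 !inE.
    by rewrite nab (negPf q1) (negPf q2) (negPf q3) (negPf q4) [d == c]eq_sym (negPf ncd).
  by move=> c4 ch; have := subset_leq_card sub; rewrite c4 ch leqNgt ltnS h_le3.
Qed.

Lemma refine_dissection : dissection refine.
Proof.
split=> [e|e f eT fT].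
  rewrite inE => /orP[/dD.1 //|]; rewrite inE => /existsP[x /existsP[y /andP[xy /eqP->]]].
  case/chordP: (xy) => nxy _ _ _; rewrite /is_diagonal cards2 nxy /=.
  by have := chord_not_edge xy; rewrite /edge negb_or => /andP[].
apply/negP => /existsP[a /existsP[b /existsP[c /existsP[d /and4P[/eqP ea /eqP ef h1 h2]]]]].
by apply: (@refine_noncrossing a b c d) => //; rewrite /edge -?ea -?ef ?eT ?fT orbT.
Qed.

(** On an edge of [D] the apex is the other neighbour, within the piece, of the end that lacks the
    colour. *)
Lemma refine_triangle a b : edge refine a b -> a != ordS b ->
  exists c, [/\ cyclic a b c, edge refine b c & edge refine c a].
Proof.
rewrite edge_refine => /orP[] ab nab.
  have [P pP cab] := piece_exists dD ab nab.
  have nba := consecutive_asym (piece_gt2 pP) cab.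
  case/consecutiveP: (cab) => aP bP nab' hab.
  case: (eqVneq (odd a) colour) => ca.
    have [c bc] := consecutive_next (piece_gt1 pP) bP.
    have ebc := piece_edge pP bc.
    have nca : c != a by apply: contraNneq nba => <-.
    case/consecutiveP: bc => _ cP nbc hbc.
    exists c; rewrite !edge_refine ebc; split=> //.
    - by have := hab _ cP; move: nab' nca nbc; clear; ordlia.
    - apply/orP; right; apply/chordP; split=> //; last by exists P.
      by rewrite (edge_parity ebc) (edge_parity ab) negbK.
  have cb : odd b = colour.
    by rewrite (edge_parity ab); case: (odd a) colour ca => [] [].
  have [c ca'] := consecutive_prev (piece_gt1 pP) aP.
  have eca := piece_edge pP ca'.
  have ncb : c != b by apply: contraNneq nba => <-.
  case/consecutiveP: ca' => cP _ nca _.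
  exists c; rewrite !edge_refine eca; split=> //.
  - by have := hab _ cP; move: nab' nca ncb; clear; ordlia.
  - apply/orP; right; apply/chordP; split=> //; [by rewrite eq_sym| |by exists P].
    by rewrite -(negbK (odd c)) -(edge_parity eca) -(edge_parity ab).
case/chordP: ab => nab' ca cb [P [pP aP bP]].
have [w bw] := consecutive_next (piece_gt1 pP) bP.
have ebw := piece_edge pP bw.
have nwb := consecutive_asym (piece_gt2 pP) bw.
case/consecutiveP: (bw) => _ wP nbw hbw.
have cw := edge_parity ebw; rewrite cb in cw.
have nwa : w != a by apply: contra_eq_neq cw => ->; rewrite ca; case: colour.
have [x wx] := consecutive_next (piece_gt1 pP) wP.
have ewx := piece_edge pP wx.
have nxb : x != b by apply: contraNneq nwb => <-.
case/consecutiveP: wx => _ xP nwx hwx.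
have cx : odd x = colour by rewrite (edge_parity ewx) cw negbK.
(* Here [x] is the next coloured vertex of the piece after [b]. If it is [a], the chord cuts off
   only [w]; otherwise [a], [b], [x] are joined by chords. *)
case: (eqVneq x a) => [xa|nxa].
  exists w; rewrite !edge_refine ebw -xa ewx; split=> //.
  have := hbw _ aP; rewrite -xa in nwa nab' *.
  by move: nab' nwa nbw; clear; ordlia.
exists x; rewrite !edge_refine; split.
- have := hbw _ aP; have := hwx _ aP; have := hbw _ xP.
  by move: nab' nwa nbw nxb nwx nxa; clear; ordlia.
- by apply/orP; right; apply/chordP; split=> //; [rewrite eq_sym|exists P].
- by apply/orP; right; apply/chordP; split=> //; exists P.
Qed.

(** By [piece_eq] one oriented edge determines a piece, so every piece is a triangle found by
    [refine_triangle]. *)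
Lemma refine_triangulation : triangulation refine.
Proof.
have dT := refine_dissection; split; [exact: dT.1|exact: dT.2|] => S pS.
have /card_gt0P[a aS] : 0 < #|S| by have := piece_gt1 pS; lia.
have [b ab] := consecutive_next (piece_gt1 pS) aS.
have eab := piece_edge pS ab.
have [c [abc ebc eca]] := refine_triangle eab (consecutive_neq_ordS pS ab).
rewrite (piece_eq dT pS (triangle_piece abc eab ebc eca) ab (triangle_consecutive abc)).
have [nab nbc nca] : [/\ a != b, b != c & c != a] by move: abc; clear; split; ordlia.
by rewrite setUC cardsU1 cards2 !inE negb_or nca nab eq_sym nbc.
Qed.

Lemma incident_refine_off a : odd a != colour ->
  incident_pieces refine a = incident_pieces D a.
Proof.
move=> ca; apply/eq_add_S; rewrite !incident_pieces_degree //; last exact: refine_dissection.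
apply: eq_card => b; rewrite !inE edge_refine.
by rewrite [chord a b]/chord (negPf ca) andbF orbF.
Qed.

(** Each piece at [a] holds [h - 1] chords at [a]. No chord is counted twice, since by
    [pieces_share] it would be an edge of [D] between vertices of equal parity. *)
Lemma card_chords a : odd a = colour ->
  #|[set b | chord a b]| = (incident_pieces D a * h.-1)%N.
Proof.
move=> ca.
pose Q b S : bool := [&& b \in S, b != a & odd b == colour].
have cnt b : (chord a b : nat) = \sum_(S | is_piece D S && (a \in S)) Q b S.
  case: (boolP (chord a b)) => [/chordP[nab _ cb [S [pS aS bS]]]|nc].
    rewrite (bigD1 S) ?pS //= {1}/Q bS cb eq_sym nab eqxx /= big1 // => S'.
    case/andP => /andP[pS' aS'] neq; rewrite /Q.
    case: (boolP (b \in S')) => //= bS'.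
    have /edge_parity := pieces_share pS' pS neq aS' aS bS' bS nab.
    by rewrite ca cb; case: colour.
  rewrite big1 // => S /andP[pS aS]; rewrite /Q.
  case: and3P => // -[bS nba /eqP cb]; case/negP: nc.
  by apply/chordP; split=> //; [rewrite eq_sym|exists S].
transitivity (\sum_b (chord a b : nat)).
  by rewrite -sum1dep_card big_mkcond /=; apply: eq_bigr => b _; case: (chord a b).
rewrite (eq_bigr _ (fun b _ => cnt b)) exchange_big /=.
rewrite (eq_bigr (fun=> h.-1)) => [|S /andP[pS aS]].
  by rewrite sum_nat_const /incident_pieces; congr (_ * _)%N; apply: eq_card => S; rewrite inE.
rewrite -(card_colour pS) (cardsD1 a) !inE aS ca eqxx /=.
rewrite -sum1_card [RHS]big_mkcond /=; apply: eq_bigr => b _.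
by rewrite !inE /Q andbCA; case: (_ && _).
Qed.

(** With [q] pieces of [D] at [a], the new degree is [(q + 1) + q (h - 1) = h q + 1]. *)
Lemma incident_refine_on a : odd a = colour ->
  incident_pieces refine a = (h * incident_pieces D a)%N.
Proof.
move=> ca; apply/eq_add_S; rewrite incident_pieces_degree; last exact: refine_dissection.
have -> : #|[set b | edge refine a b]| =
    (#|[set b | edge D a b]| + #|[set b | chord a b]|)%N.
  rewrite -cardsUI [X in _ = (_ + X)%N]eq_card0 ?addn0.
    by apply: eq_card => b; rewrite !inE edge_refine.
  move=> b; rewrite !inE; apply/andP => -[ab c].
  by have := chord_not_edge c; rewrite ab.
rewrite -incident_pieces_degree // card_chords // addSn; congr _.+1.
by case: h half_gt1 => // k _; rewrite /= mulSn mulnC.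
Qed.

End EvenAngulation.
End TwoColour.

(** * Friezes *)

Section Frieze.
Local Open Scope ring_scope.
Variable n : nat.
Local Notation vertex := 'I_n.+3.
Local Notation N := (n.+3%:Z).

Lemma vertex_modMDl (q r : int) : vertex_mod n (q * N + r) = vertex_mod n r.
Proof. by rewrite /vertex_mod modzMDl. Qed.

Lemma vertex_mod_ord (x : vertex) : vertex_mod n (x : nat)%:Z = x.
Proof.
apply/ord_inj; rewrite /vertex_mod modz_small ?inordK ?absz_nat ?ltn_ord //.
by rewrite /= ltz_nat ltn_ord.
Qed.

Lemma modN_decomp (i : int) : exists q (x : vertex), i = q * N + (x : nat)%:Z.
Proof.
have h0 : 0 <= (i %% N)%Z by exact: modz_ge0.
have hN : (`|(i %% N)%Z| < n.+3)%N by have := ltz_pmod i (isT : 0 < N); lia.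
exists (i %/ N)%Z, (Ordinal hN); rewrite [LHS](divz_eq i N) /=; lia.
Qed.

Lemma vertex_mod_succ (x : vertex) : vertex_mod n ((x : nat)%:Z + 1) = ordS x.
Proof.
have hx := ltn_ord x; case: (ltnP x n.+2) => h.
  rewrite -[RHS]vertex_mod_ord; congr vertex_mod; rewrite val_ordS h; lia.
have -> : (x : nat)%:Z + 1 = 1 * N + (@ord0 n.+2 : nat)%:Z by rewrite /=; lia.
rewrite vertex_modMDl vertex_mod_ord; apply/ord_inj; rewrite val_ordS.
by case: ifP => //; lia.
Qed.

Lemma odd_vertex_mod (i : int) : odd n -> odd (vertex_mod n i) = odd `|i|%N.
Proof.
move=> on; have [q [x ->]] := modN_decomp i.
rewrite vertex_modMDl vertex_mod_ord.
have -> : odd `|(q * N + (x : nat)%:Z)%R|%N = odd `|(q * N)%R|%N (+) odd `|(x : nat)%:Z|%N :> bool.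
  by lia.
by rewrite abszM oddM !absz_nat /= on andbF.
Qed.

(** The extension of [f] to all integers that changes sign after each period [n + 3]; the boundary
    equations of [recurrent] then become the inner one. *)
Definition antiperiodic (f : vertex -> int) (i : int) : int :=
  (-1) ^ (i %/ N)%Z * f (vertex_mod n i).

Lemma antiperiodicMDl f (q r : int) :
  antiperiodic f (q * N + r) = (-1) ^ q * antiperiodic f r.
Proof. by rewrite /antiperiodic divzMDl // vertex_modMDl exprzDr ?mulrA. Qed.

Lemma antiperiodic_ord f (x : vertex) : antiperiodic f (x : nat)%:Z = f x.
Proof.
rewrite /antiperiodic vertex_mod_ord divz_small ?mul1r //=.
by rewrite ltz_nat ltn_ord.
Qed.

Lemma antiperiodicDN f i : antiperiodic f (i + N) = - antiperiodic f i.
Proof.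
have -> : i + N = 1 * N + i by ring.
by rewrite antiperiodicMDl expr1z mulN1r.
Qed.

Lemma antiperiodicBN f i : antiperiodic f (i - N) = - antiperiodic f i.
Proof. by rewrite -[in RHS](subrK N i) antiperiodicDN opprK. Qed.

Lemma antiperiodic_recurrent (T : {set {set vertex}}) f : dissection T ->
  recurrent T ord0 ord_max f -> forall i : int,
  antiperiodic f (i - 1) + antiperiodic f (i + 1) =
  antiperiodic f i *+ incident_pieces T (vertex_mod n i).
Proof.
move=> dT [f1 f2 f3] i; have [q [x ->]] := modN_decomp i.
have -> : q * N + (x : nat)%:Z - 1 = q * N + ((x : nat)%:Z - 1) by ring.
have -> : q * N + (x : nat)%:Z + 1 = q * N + ((x : nat)%:Z + 1) by ring.
rewrite !antiperiodicMDl vertex_modMDl -mulrDr -mulrnAr; congr (_ * _).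
rewrite vertex_mod_ord antiperiodic_ord.
have ext (y : vertex) (j : int) : j = (y : nat)%:Z -> antiperiodic f j = f y.
  by move=> ->; exact: antiperiodic_ord.
have hx := ltn_ord x.
have d := degree_in_full x dT.
case: (posnP x) => [x0|x0].
  have ex : x = ord0 by [exact: ord_inj]; subst x.
  have h1 : (1 < n.+3)%N by [].
  rewrite -[_ - 1](addrK N) antiperiodicBN.
  rewrite (ext ord_max); last by rewrite /=; lia.
  rewrite (ext (Ordinal h1)) //.
  have := f1 (Ordinal h1) erefl; rewrite d mulrS /=; lia.
have hp : (x.-1 < n.+3)%N by lia.
rewrite (ext (Ordinal hp)) /=; last by lia.
case: (ltnP x n.+2) => xm.
  have hs : (x.+1 < n.+3)%N by lia.
  rewrite (ext (Ordinal hs)) /=; last by lia.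
  have := f3 (Ordinal hp) x (Ordinal hs) isT (esym (prednK x0)) erefl xm.
  by rewrite d mulrS; lia.
have ex : x = ord_max by apply: ord_inj => /=; lia.
subst x; have -> : (@ord_max n.+2 : nat)%:Z + 1 = (@ord0 n.+2 : nat)%:Z + N by rewrite /=; lia.
rewrite antiperiodicDN antiperiodic_ord.
have := f2 (Ordinal hp); rewrite d mulrS => /(_ (prednK x0)).
lia.
Qed.

(** * The frieze of determinants *)

Section FromVectors.
Variables (T : {set {set vertex}}) (X Y : vertex -> int).
Hypothesis dT : dissection T.
Hypotheses (X0 : X ord0 = 1) (Xm : X ord_max = 0).
Hypotheses (Y0 : Y ord0 = 0) (Ym : Y ord_max = 1).
Hypotheses (rX : recurrent T ord0 ord_max X) (rY : recurrent T ord0 ord_max Y).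
Hypothesis det_pos : forall x y : vertex, (x < y)%N ->
  0 < det X Y x y /\ edge T x y = (det X Y x y == 1).

Local Notation x_ := (antiperiodic X).
Local Notation y_ := (antiperiodic Y).
Let dt (i j : int) : int := x_ i * y_ j - x_ j * y_ i.

Let dtMDl (q i j : int) : dt (q * N + i) (q * N + j) = dt i j.
Proof.
rewrite /dt !antiperiodicMDl.
have s : ((-1) ^ q) * ((-1) ^ q) = 1 :> int by rewrite -exprzMl // mulrNN mulr1 exp1rz.
transitivity ((-1) ^ q * (-1) ^ q * (x_ i * y_ j - x_ j * y_ i)); first by ring.
by rewrite s mul1r.
Qed.

Let dt_ord (x y : vertex) : dt (x : nat)%:Z (y : nat)%:Z = det X Y x y.
Proof. by rewrite /dt !antiperiodic_ord. Qed.

Let dt_wrap (i j : int) : dt i (j + N) = dt j i.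
Proof. by rewrite /dt !antiperiodicDN; ring. Qed.

Let dt_succ (i : int) : dt i (i + 1) = 1.
Proof.
have [q [x ->]] := modN_decomp i.
rewrite -addrA dtMDl; have hx := ltn_ord x; case: (ltnP x n.+2) => xm.
  have hs : (x.+1 < n.+3)%N by lia.
  have -> : (x : nat)%:Z + 1 = (Ordinal hs : nat)%:Z by rewrite /=; lia.
  rewrite dt_ord; apply/eqP; have [_ <-] := det_pos (y := Ordinal hs) (ltnSn x).
  exact: edge_succ.
have -> : x = ord_max by apply: ord_inj => /=; lia.
have -> : (@ord_max n.+2 : nat)%:Z + 1 = (@ord0 n.+2 : nat)%:Z + N by rewrite /=; lia.
by rewrite dt_wrap dt_ord /det X0 Xm Y0 Ym.
Qed.

Let dt_gt0 (i j : int) : i < j -> j < i + N -> 0 < dt i j.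
Proof.
have [q [x ->]] := modN_decomp i; rewrite -[j](subrKC (q * N)) => h1 h2.
rewrite dtMDl; move: (j - q * N) h1 h2 => {}j.
rewrite ltrD2l -addrA ltrD2l => h1 h2; have hx := ltn_ord x.
case: (ltrP j N) => hj.
  have hjN : (`|j|%N < n.+3)%N by lia.
  have ej : j = (Ordinal hjN : nat)%:Z by rewrite /=; lia.
  rewrite ej dt_ord; apply: (det_pos _).1; rewrite /=; lia.
have hjN : (`|(j - N)%R|%N < n.+3)%N by lia.
have -> : j = (Ordinal hjN : nat)%:Z + N by rewrite /=; lia.
by rewrite dt_wrap dt_ord; apply: (det_pos _).1; rewrite /=; lia.
Qed.

Let dt_quiddity (i : int) : dt (i - 1) (i + 1) = incident_pieces T (vertex_mod n i).
Proof.
pose k : int := incident_pieces T (vertex_mod n i).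
have step f : recurrent T ord0 ord_max f ->
    antiperiodic f (i + 1) = antiperiodic f i * k - antiperiodic f (i - 1).
  move=> rf; have := antiperiodic_recurrent dT rf i.
  by rewrite -mulr_natr natz -/k => <-; ring.
have e : dt (i - 1) i = 1 by rewrite -{2}[i](subrK 1) dt_succ.
transitivity (k * dt (i - 1) i); last by rewrite e mulr1.
rewrite /dt !step //; ring.
Qed.

Lemma vectors_frieze (R : realType) : exists m : int -> int -> R,
  is_frieze n m /\ forall i, m i i = (incident_pieces T (vertex_mod n i))%:R.
Proof.
(* With this shift the rows of zeros pair a vector with plus or minus itself, and the rows of ones
   pair neighbours. *)
exists (fun i j => (dt (i - 1) (j + 1))%:~R); split; last first.
  by move=> i; rewrite dt_quiddity pmulrn.
split=> [i|i|i r r0 rn|i r r1 rn].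
- split.
    have -> : i - 2 + 1 = i - 1 by ring.
    by rewrite /dt subrr.
  have -> : i + n%:Z + 1 + 1 = i - 1 + N by lia.
  by rewrite dt_wrap /dt subrr.
- split.
    by rewrite subrK -{2}[i](subrK 1) dt_succ.
  have -> : i + n%:Z + 1 = i - 2 + N by lia.
  have -> : i - 1 = i - 2 + 1 by ring.
  by rewrite dt_wrap dt_succ.
- by rewrite ltr0z dt_gt0 //; lia.
- rewrite -!intrM -intrB.
  have -> : i + 1 - 1 = i by ring.
  (* The unimodular rule is the Plücker relation for the vectors at [i - 1], [i], [s] and
     [s + 1]. *)
  pose s := i + r + 1.
  have -> : dt (i - 1) s * dt i (s + 1) - dt i s * dt (i - 1) (s + 1)
    = dt (i - 1) i * dt s (s + 1) by rewrite /dt; ring.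
  by rewrite dt_succ -{2}[i](subrK 1) dt_succ.
Qed.

End FromVectors.

Lemma triangulation_frieze (R : realType) (T : {set {set vertex}}) : triangulation T ->
  exists m : int -> int -> R,
  is_frieze n m /\ forall i, m i i = (incident_pieces T (vertex_mod n i))%:R.
Proof.
move=> hT; have [X [Y [[X0 Xm Y0 Ym] rX rY h]]] := triangulation_vectors hT.
exact: (vectors_frieze (p_angulation_dissection hT) X0 Xm Y0 Ym rX rY h).
Qed.

(** In the unimodular rule one product has both factors in even rows and gains
    [s i * s (i + 1) = 1]; the other is unchanged. As [n] is odd, both rows of ones are odd and stay
    unscaled. *)
Lemma frieze_rescale (R : realType) (m : int -> int -> R) (s : int -> R) : odd n ->
  (forall i, 0 < s i) -> (forall i, s i * s (i + 1) = 1) -> is_frieze n m ->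
  is_frieze n (fun i j => if odd `|(j - i)%R|%N then m i j else s i * m i j).
Proof.
move=> on s0 s1 [f0 f1 fpos funi].
split=> [i|i|i r r0 rn|i r r1 rn].
- have [-> ->] := f0 i; rewrite !mulr0; by split; case: ifP.
- have [-> ->] := f1 i; split; rewrite ifT //; lia.
- have h := fpos i r r0 rn; case: ifP => // _; exact: mulr_gt0.
- rewrite -(funi i r r1 rn).
  have -> : odd `|(i + r - i)%R|%N = odd `|r|%N by congr odd; lia.
  have -> : odd `|(i + r + 1 - (i + 1))%R|%N = odd `|r|%N by congr odd; lia.
  have -> : odd `|(i + r - (i + 1))%R|%N = ~~ odd `|r|%N by lia.
  have -> : odd `|(i + r + 1 - i)%R|%N = ~~ odd `|r|%N by lia.
  case: (odd _) => /=; rewrite mulrACA ?s1 ?mul1r //.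
  by rewrite [s (i + 1) * s i]mulrC s1 mul1r.
Qed.

Lemma frieze_first_row (R : realType) (m : int -> int -> R) (i : int) : is_frieze n m ->
  m i i * m (i + 1) (i + 1) = m i (i + 1) + 1.
Proof.
case=> _ f1 _ funi; have := funi i 0 (ltac:(lia)) (ltac:(lia)); rewrite addr0.
have [+ _] := f1 (i + 1); rewrite addrK => ->.
by rewrite mul1r => /(canRL (subrK _)) ->; rewrite addrC.
Qed.

End Frieze.

(** * The values of [lambda] at 3, 4 and 6 *)

Section Lambda.
Local Open Scope ring_scope.
Variable R : realType.

Lemma cos_triple (x : R) : cos (x *+ 3) = 4 * cos x ^+ 3 - 3 * cos x.
Proof.
have s : sin x ^+ 2 = 1 - cos x ^+ 2 by rewrite -(cos2Dsin2 x); ring.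
rewrite !mulrS mulr0n addr0 cosD cosD sinD; ring: s.
Qed.

Lemma cos_pi_div_gt0 k : (2 < k)%N -> 0 < cos (pi / k%:R : R).
Proof.
move=> hk; apply: cos_gt0_pihalf.
have hp := pi_gt0 R; have h2 : (2 : R) < k%:R by rewrite (ltr_nat R 2).
have hk0 : (0 : R) < k%:R by apply: lt_trans h2.
have p1 : 0 < pi / k%:R :> R by exact: divr_gt0.
have -> : pi / k%:R < pi / 2 :> R by rewrite ltr_pM2l // ltf_pV2 ?posrE.
by rewrite andbT; apply: lt_trans p1; rewrite oppr_lt0; exact: divr_gt0.
Qed.

Lemma lambda_gt0 k : (2 < k)%N -> 0 < lambda R k.
Proof. by move=> hk; rewrite mulr_gt0 // cos_pi_div_gt0. Qed.

Lemma lambda3 : lambda R 3 = 1.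
Proof.
have c0 := cos_pi_div_gt0 (isT : (2 < 3)%N).
have e : cos (pi / 3 *+ 3) = -1 :> R by rewrite -mulr_natr divfK ?cospi // pnatr_eq0.
rewrite cos_triple in e; rewrite /lambda; set c := cos _ in c0 e *.
(* This factors [4 c^3 - 3 c + 1], and [c > 0] leaves [c = 1/2]. *)
have : (c + 1) * (2 * c - 1) ^+ 2 = 0 by move: e => /eqP; rewrite -subr_eq0 => /eqP <-; ring.
move/eqP; rewrite mulf_eq0 sqrf_eq0 => /orP[]/eqP h; lra.
Qed.

Lemma lambda4_sqr : lambda R 4 ^+ 2 = 2.
Proof.
have e : cos (pi / 4 *+ 2) = 0 :> R.
  by rewrite -cos_pihalf; congr cos; field.
by rewrite cos_mulr2n in e; rewrite /lambda; move: e; set c := cos _; lra.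
Qed.

Lemma lambda6_sqr : lambda R 6 ^+ 2 = 3.
Proof.
have c0 := cos_pi_div_gt0 (isT : (2 < 6)%N).
have e : cos (pi / 6 *+ 3) = 0 :> R.
  by rewrite -cos_pihalf; congr cos; field.
rewrite cos_triple in e; rewrite /lambda; set c := cos _ in c0 e *.
have : c * (4 * c ^+ 2 - 3) = 0 by rewrite -e; ring.
move/eqP; rewrite mulf_eq0 gt_eqF //= => /eqP h; lra.
Qed.

End Lambda.

(** * Friezes that coincide in every second row *)

Section Coincidence.
Local Open Scope ring_scope.
Variables (R : realType) (n h : nat) (D : {set {set 'I_n.+3}}).
Hypothesis hD : p_angulation h.*2 D.
Hypothesis h23 : (h == 2) || (h == 3).
Hypothesis lambda_sqr : lambda R h.*2 ^+ 2 = h%:R.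

Let lambda_pos : 0 < lambda R h.*2.
Proof. by apply: lambda_gt0; lia. Qed.

Let h_le3 : (h <= 3)%N.
Proof. by lia. Qed.

Lemma refine_coincides colour : exists m m' : int -> int -> R,
  [/\ frieze_of_type h.*2 D m, conway_coxeter (refine D colour) m'
    & coincide_every_second_row n m m'].
Proof.
have hT := refine_triangulation hD colour h_le3.
have [m [fm qm]] := triangulation_frieze R hT.
have on := width_odd hD.
(* The quiddity of the triangulation is [h q = lambda^2 q] at coloured vertices and [q] at the
   others, so this scaling makes it [lambda q] everywhere. *)
pose s (i : int) : R := if odd `|i|%N == colour then (lambda R h.*2)^-1 else lambda R h.*2.
have l0 : lambda R h.*2 != 0 by rewrite gt_eqF.
have s0 i : 0 < s i by rewrite /s; case: ifP => _; rewrite ?invr_gt0.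
have s1 i : s i * s (i + 1) = 1.
  rewrite /s; have -> : odd `|(i + 1)%R|%N = ~~ odd `|i|%N by lia.
  by case: (odd _); case: (colour); rewrite /= ?mulVf ?mulfV.
exists (fun i j => if odd `|(j - i)%R|%N then m i j else s i * m i j), m; split.
- split; first exact: frieze_rescale.
  move=> i; rewrite subrr /= qm /s -(odd_vertex_mod i on).
  case: eqP => [c|/eqP c].
    rewrite (incident_refine_on hD h_le3 c) natrM -lambda_sqr expr2 -mulrA.
    by rewrite mulKf.
  by rewrite (incident_refine_off hD h_le3 c).
- by split=> // i; rewrite lambda3 mul1r.
- by move=> i r _ _ ro; rewrite addrC addKr ro.
Qed.

(** The entry in row 1, shared by both friezes, is one less than the product of two neighbouring
    quiddity entries. *)
Lemma adjacent_incident (T : {set {set 'I_n.+3}}) (m m' : int -> int -> R) x :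
  frieze_of_type h.*2 D m -> conway_coxeter T m' -> coincide_every_second_row n m m' ->
  (incident_pieces T x * incident_pieces T (ordS x) =
   h * (incident_pieces D x * incident_pieces D (ordS x)))%N.
Proof.
move=> [fm qm] [fm' qm'] co; pose i : int := (x : nat)%:Z.
have e := frieze_first_row i fm; have e' := frieze_first_row i fm'.
have c : m i (i + 1) = m' i (i + 1) by apply: co; lia.
rewrite c -e' !qm !qm' vertex_mod_ord vertex_mod_succ lambda3 !mul1r in e.
apply/eqP; rewrite -(eqr_nat R) !natrM -e -lambda_sqr; apply/eqP; ring.
Qed.

Lemma ordS_ind (P : 'I_n.+3 -> Prop) u : P u -> (forall x, P x -> P (ordS x)) -> forall x, P x.
Proof.
move=> Pu Ps x; have hd : (dist u x < n.+3)%N by rewrite /dist; ordlia.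
suff h1 k : (k < n.+3)%N -> exists2 y, P y & dist u y = k.
  by have [y Py /dist_inj <-] := h1 _ hd.
elim: k => [|k IH] hk; first by exists u => //; exact: distxx.
have [y Py ek] := IH (ltnW hk); exists (ordS y); first exact: Ps.
by rewrite dist_succ ek.
Qed.

Lemma coincides_refine (T : {set {set 'I_n.+3}}) (m m' : int -> int -> R) :
  triangulation T ->
  frieze_of_type h.*2 D m -> conway_coxeter T m' -> coincide_every_second_row n m m' ->
  exists colour, T = refine D colour.
Proof.
move=> hT fD fT co; have adj x := adjacent_incident x fD fT co.
have [u [q1 q2]] := adjacent_ears hD.
(* At the first of two adjacent ears the count for [T] divides the prime [h]; whether it is 1 or [h]
   decides the colour. *)
have start : exists colour,
    incident_pieces T u = ((if odd u == colour then h else 1) * incident_pieces D u)%N.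
  have := adj u; rewrite q1 q2 !muln1.
  case: (eqVneq (incident_pieces T u) 1%N) => [->|n1] e.
    by exists (~~ odd u); case: (odd u).
  exists (odd u); rewrite eqxx muln1.
  have dv : (incident_pieces T u %| h)%N by rewrite -e dvdn_mulr.
  have ph : prime h by case/orP: h23 => /eqP->.
  by have /primeP[_ /(_ _ dv)/pred2P[e1|//]] := ph; rewrite e1 in n1.
have [colour start'] := start; exists colour.
apply: triangulation_rigid => //; first exact: (refine_triangulation hD colour h_le3).
move=> x; have -> : incident_pieces (refine D colour) x =
    ((if odd x == colour then h else 1) * incident_pieces D x)%N.
  case: eqP => [c|/eqP c]; first exact: (incident_refine_on hD h_le3 c).
  by rewrite mul1n; exact: (incident_refine_off hD h_le3 c).
(* Going around the polygon, the product relation fixes the count at [ordS x] from the one at [x],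
   since the counts for [D] are positive. *)
move: x; apply: (ordS_ind start') => x e; have := adj x.
have o : odd (ordS x) = ~~ odd x by exact: (edge_parity hD (edge_ordS D x)).
have p1 := incident_pieces_gt0 hD x.
rewrite e o => a.
have h0 : (0 < h)%N by lia.
apply/eqP; move/eqP: a; case: (odd x =P colour) => c.
  have -> : (~~ odd x == colour) = false by rewrite -c; case: (odd x).
  by rewrite mul1n -mulnA eqn_pmul2l // eqn_pmul2l.
have -> : (~~ odd x == colour) by move: c; case: (odd x); case: (colour).
by rewrite mul1n mulnCA eqn_pmul2l.
Qed.

(** At vertex 0 the two have [q] and [h q] triangles, with [q > 0] and [h > 1]. *)
Lemma refine_neq : refine D true <> refine D false.
Proof.
move=> e; have h1 := half_gt1 hD; have q0 := incident_pieces_gt0 hD ord0.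
have := incident_refine_on hD h_le3 (colour := false) (a := ord0) erefl.
rewrite -e (incident_refine_off hD h_le3) // => /eqP.
by rewrite -{1}[incident_pieces _ _]mul1n eqn_pmul2r //; lia.
Qed.

End Coincidence.

Theorem theorem7 (R : realType) (n p : nat) (hp : p = 4 \/ p = 6)
    (D : {set {set 'I_n.+3}}) (hD : p_angulation p D) :
  exists T1 T2 : {set {set 'I_n.+3}},
    T1 <> T2 /\
    forall T : {set {set 'I_n.+3}},
      (triangulation T /\
       exists m m' : int -> int -> R,
         [/\ frieze_of_type p D m, conway_coxeter T m'
           & coincide_every_second_row n m m'])
      <-> (T = T1 \/ T = T2).
Proof.
(* For both values of [p], the half of [p] is also the square of [lambda], and it is prime. *)
have [h [ph h23 l2]] : exists h, [/\ p = h.*2, (h == 2) || (h == 3)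
    & (lambda R h.*2 ^+ 2 = h%:R)%R].
  by case: hp => ->; [exists 2; rewrite lambda4_sqr|exists 3; rewrite lambda6_sqr].
subst p; have h3 : (h <= 3)%N by lia.
exists (refine D true), (refine D false); split; first exact: refine_neq hD h23.
move=> T; split=> [[hT [m [m' [fD fT co]]]]|hT].
  have [[] ->] := coincides_refine hD h23 l2 hT fD fT co; by [left|right].
have [colour ->] : exists colour, T = refine D colour.
  by case: hT => ->; [exists true|exists false].
split; [exact: refine_triangulation hD colour h3|exact: refine_coincides hD h23 l2 colour].
Qed.
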